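(* Let $K\subseteq\mathbb{R}^n$ be an unbounded star-shaped set, let $\sigma>0$ and $\varepsilon\in(0,\tfrac{1}{32})$. For a constant $c>0$ define $$\delta^*=\sup\Big\{\delta\ge 0:\ N\frac{\delta^2}{\sigma^2}\le \log M^{\mathrm{loc}}(\delta,c)\Big\}.$$ Then, for $c$ a sufficiently large absolute constant and under the assumption $N\gtrsim \sup_{\delta>0}\log M^{\mathrm{loc}}(\delta,c)$, the minimax risk satisfies $$\mathfrak{M}\asymp \max\big(\delta^{*2},\ \varepsilon\sigma^2\big).$$
   Context: Model: fix integers $n,N\ge 1$, $\sigma>0$ and a contamination level $\varepsilon$. The unknown mean $\mu$ lies in a known set $K\subseteq\mathbb{R}^n$. The uncorrupted sample is $\tilde X_i=\mu+\xi_i$, $i=1,\dots,N$, where the $\xi_i$ are i.i.d. copies of a random vector $\xi$ whose distribution belongs to $\Xi_{\sigma^2}$, the family of all distributions on $\mathbb{R}^n$ with mean zero and covariance matrix $\Sigma\preceq\sigma^2 I$. An adversary $\mathcal{C}$, which may inspect the entire uncorrupted sample and knows the model and the estimator, replaces at most a fraction $\varepsilon$ of the $N$ points by arbitrary points; the statistician observes $X=\mathcal{C}(\tilde X)$. The minimax risk is $$\mathfrak{M}=\inf_{\hat\mu}\sup_{\mu\in K}\sup_{\xi\in\Xi_{\sigma^2}}\sup_{\mathcal{C}}\mathbb{E}_\mu\big\|\hat\mu(\mathcal{C}(\tilde X))-\mu\big\|^2,$$ the infimum over all estimators, $\|\cdot\|$ the Euclidean norm. Star-shaped: there is $k^*\in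 K$ with $(1-t)k^*+tk\in K$ for all $k\in K$, $t\in[0,1]$. Local metric entropy: $M(\eta,A)$ is the maximal cardinality of a subset of $A$ with pairwise distances $>\eta$; $M^{\mathrm{loc}}(\eta,c)=\sup_{\nu\in K}M(\eta/c,\ B(\nu,\eta)\cap K)$ with $B(\nu,\eta)$ the closed Euclidean ball. $\asymp$, $\gtrsim$: up to multiplicative constants not depending on $n,N,\sigma,\varepsilon,K$. *)

(* Defs.v *)
(* Points of R^n are n-tuples of reals
   (so that R^n and the sample space (R^n)^N carry their product Borel
   sigma-algebras, via mathcomp-analysis' measurable structure on tuples). *)
From HB Require Import structures.
From mathcomp Require Import all_boot all_order all_algebra.
From mathcomp Require Import all_classical all_reals all_analysis.
Set Implicit Arguments.
Unset Strict Implicit.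
Unset Printing Implicit Defensive.
Import Order.TTheory GRing.Theory Num.Theory.
Local Open Scope classical_set_scope.
Local Open Scope ring_scope.

Section Defs.
Variable R : realType.

Definition vadd n (x y : n.-tuple R) : n.-tuple R := [tuple tnth x i + tnth y i | i < n].
Definition vsub n (x y : n.-tuple R) : n.-tuple R := [tuple tnth x i - tnth y i | i < n].
Definition vscale n (t : R) (x : n.-tuple R) : n.-tuple R := [tuple t * tnth x i | i < n].
Definition enorm n (x : n.-tuple R) : R := Num.sqrt (\sum_(i < n) tnth x i ^+ 2).

Definition cball n (nu : n.-tuple R) (eta : R) : set (n.-tuple R) :=
  [set x | enorm (vsub x nu) <= eta].

Definition star_shapedE n (K : set (n.-tuple R)) : Prop :=
  exists2 ks, K ks & forall k t, K k -> 0 <= t <= 1 ->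
    K (vadd (vscale (1 - t) ks) (vscale t k)).

Definition bounded_eucl n (K : set (n.-tuple R)) : Prop :=
  exists r : R, forall x, K x -> enorm x <= r.

Definition packing n (eta : R) (A : set (n.-tuple R)) (S : seq (n.-tuple R)) : Prop :=
  uniq S /\ (forall x, x \in S -> A x) /\
  (forall x y, x \in S -> y \in S -> x != y -> eta < enorm (vsub x y)).

Definition packing_number n (eta : R) (A : set (n.-tuple R)) : \bar R :=
  ereal_sup [set ((size S)%:R)%:E | S in packing eta A].

Definition Mloc n (K : set (n.-tuple R)) (eta c : R) : \bar R :=
  ereal_sup [set packing_number (eta / c) (cball nu eta `&` K) | nu in K].

Definition elog (x : \bar R) : \bar R :=
  match x with
  | EFin r => (ln r)%:E
  | EPInf => +oo%E
  | ENInf => -oo%E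
  end.

Definition delta_star n (K : set (n.-tuple R)) (N : nat) (sigma c : R) : \bar R :=
  ereal_sup [set d%:E | d in [set d : R | 0 <= d /\
      ((N%:R * d ^+ 2 / sigma ^+ 2)%:E <= elog (Mloc K d c))%E]].

Section Noise.
Context {d : measure_display} {Omega : measurableType d}.
Variable P : probability Omega R.

Definition coord n (X : Omega -> n.-tuple R) (j : 'I_n) : Omega -> R :=
  fun w => tnth (X w) j.

Definition mean_vec n (X : Omega -> n.-tuple R) : 'rV[R]_n :=
  \row_j Rintegral P setT (coord X j).

Definition cov_mx n (X : Omega -> n.-tuple R) : 'M[R]_n :=
  \matrix_(j, k) Rintegral P setT
     (fun w => (coord X j w - mean_vec X 0 j) * (coord X k w - mean_vec X 0 k)).

Definition in_Xi n (sigma : R) (X : Omega -> n.-tuple R) : Prop :=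
  measurable_fun setT X /\
  (forall j, P.-integrable setT (fun w => (coord X j w)%:E)) /\
  (forall j, P.-integrable setT (fun w => (coord X j w ^+ 2)%:E)) /\
  mean_vec X = 0 /\
  (forall u : 'rV[R]_n, 0 <= (u *m (sigma ^+ 2)%:M *m u^T) 0 0 - (u *m cov_mx X *m u^T) 0 0).

Definition iid_Xi n N (sigma : R) (xi : 'I_N -> Omega -> n.-tuple R) : Prop :=
  (forall i, in_Xi sigma (xi i)) /\
  (forall i j (B : set (n.-tuple R)), measurable B ->
      P (xi i @^-1` B) = P (xi j @^-1` B)) /\
  (forall B : 'I_N -> set (n.-tuple R), (forall i, measurable (B i)) ->
      P (\bigcap_(i in [set: 'I_N]) (xi i @^-1` B i)) =
      (\prod_(i < N) P (xi i @^-1` B i))%E).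
End Noise.

Definition sample n N := N.-tuple (n.-tuple R).

Definition adversary n N (eps : R) (C : sample n N -> sample n N) : Prop :=
  measurable_fun setT C /\
  forall x : sample n N,
    (#|[pred i : 'I_N | tnth (C x) i != tnth x i]|%:R <= eps * N%:R).

Definition risk {d : measure_display} {Omega : measurableType d}
  (P : probability Omega R) n N (xi : 'I_N -> Omega -> n.-tuple R)
  (mu : n.-tuple R) (muhat : sample n N -> n.-tuple R)
  (C : sample n N -> sample n N) : \bar R :=
  (\int[P]_w (enorm (vsub (muhat (C [tuple vadd mu (xi i w) | i < N])) mu) ^+ 2)%:E)%E.

Definition minimax_risk n N (K : set (n.-tuple R)) (sigma eps : R) : \bar R :=
  ereal_inf [set r | exists muhat : sample n N -> n.-tuple R,
    measurable_fun setT muhat /\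
    r = ereal_sup [set e | exists mu, K mu /\
          exists (d : measure_display) (Omega : measurableType d)
                 (P : probability Omega R) (xi : 'I_N -> Omega -> n.-tuple R),
            iid_Xi P sigma xi /\
            exists C, adversary eps C /\ e = risk P xi mu muhat C]].

End Defs.

(* Main.v *)
Require Import Defs.
From HB Require Import structures.
From mathcomp Require Import all_boot all_order all_algebra finmap.
From mathcomp Require Import all_classical all_reals all_analysis.
From mathcomp Require Import measurable_realfun.
From mathcomp Require Import ring lra.
Set Implicit Arguments.
Unset Strict Implicit.
Unset Printing Implicit Defensive.
Import Order.TTheory GRing.Theory Num.Theory.
Local Open Scope classical_set_scope.
Local Open Scope ring_scope.

(** Upper bound.  Put [eta = max (2 delta^*, sigma sqrt eps)] and let [G] be a
    maximal [eta]-packing of [K].  Two points [v], [v'] of [G] at distance [D]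
    are compared through the scores [sum_i g_D (<X_i - v, (v' - v) / D>)], where
    [g_D] is a clipped linear function when [D <= kappa sigma] and a large
    multiple of the sign otherwise.  Since [g_D] is bounded, the adversary shifts
    a score by at most [O(eps N |g_D|)], and a quadratic majorant of [exp g_D]
    gives an exponential tail using second moments only.  The estimator is a
    point of [G] whose furthest victorious opponent is as close as possible; its
    squared error is at most a constant times [eta^2] plus the sum of [D^2] over
    the points which wrongly beat the point of [G] next to [mu].  The number of
    points of [G] in a shell of radius [c^l eta] is at most [M^loc(eta)^(l+2)],
    which the tail absorbs.

    Lower bound.  All noises are finitely supported.  For [eps sigma^2], the
    adversary erases the rare atom of a two-point law.  For [delta^*^2], the law
    with mean [v] is the product law on the vertices of a cube of half-width
    [sigma] whose mean is [v], and a second moment argument replaces Fano's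
    inequality.  The noise may depend on [mu], so that all hypotheses share the
    same sample space. *)

(** * Euclidean geometry and packings *)

(** The obstacle above is that [K] is unbounded while the noise has two moments only, so infinitely
    many shells must be summed. A score clipped at a fixed level has an error exponent that
    saturates with the distance [D]. Multiplying the sign by [ln (D / sigma)] lets Chebyshev's
    inequality give a factor of order [sigma / D] per observation, hence an exponent of order
    [N ln (D / sigma)]. Shell number [l] costs [(l + 2) ln Mloc], and [ln D] grows linearly in [l];
    the balance holds as soon as [N] exceeds a multiple of [ln Mloc], and this is where the
    sample-size assumption acts. It also forces every admissible [delta] to be at most [sigma],
    which keeps the cube laws of the lower bound genuine probabilities. Unboundedness gives
    [Mloc >= 16] at every scale, so [ln Mloc] is bounded below and absorbs numerical constants in
    both bounds. Star shape makes [Mloc] nonincreasing in the radius, so one number [Q] controls all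
    scales above [eta]. *)

Lemma size_le_sum_cover (T U : eqType) (s : seq T) (t : seq U) (r : T -> U -> bool) :
  (forall x, x \in s -> exists2 y, y \in t & r x y) ->
  (size s <= \sum_(y <- t) size [seq x <- s | r x y])%N.
Proof.
move=> cov; under eq_bigr do rewrite size_filter -sum1_count big_mkcond /=.
rewrite exchange_big /= -sum1_size big_seq [leqRHS]big_seq; apply: leq_sum => x xs.
have [y yt rxy] := cov x xs.
by rewrite (big_rem y) //= rxy.
Qed.

Section Euclid.
Context {R : realType} {n : nat}.
Implicit Types x y z a u : n.-tuple R.

Definition vdot x y : R := \sum_(i < n) tnth x i * tnth y i.

Lemma tnth_vadd x y i : tnth (vadd x y) i = tnth x i + tnth y i.
Proof. exact: tnth_mktuple. Qed.

Lemma tnth_vsub x y i : tnth (vsub x y) i = tnth x i - tnth y i.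
Proof. exact: tnth_mktuple. Qed.

Lemma tnth_vscale t x i : tnth (vscale t x) i = t * tnth x i.
Proof. exact: tnth_mktuple. Qed.

Definition tnthE := (tnth_vadd, tnth_vsub, tnth_vscale).

Lemma enorm_ge0 x : 0 <= enorm x.
Proof. exact: sqrtr_ge0. Qed.

Lemma sqr_enorm x : enorm x ^+ 2 = \sum_(i < n) tnth x i ^+ 2.
Proof. by rewrite sqr_sqrtr // sumr_ge0 // => i _; rewrite sqr_ge0. Qed.

Lemma enorm_dot x : enorm x ^+ 2 = vdot x x.
Proof. by rewrite sqr_enorm; apply: eq_bigr => i _; rewrite expr2. Qed.

Lemma vdot_sqr_le x y : vdot x y ^+ 2 <= enorm x ^+ 2 * enorm y ^+ 2.
Proof.
set a := enorm x ^+ 2; set b := enorm y ^+ 2; set s := vdot x y.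
have b0 : 0 <= b by rewrite sqr_ge0.
(* The residual of [x] along [y], scaled by [b] to avoid a division. *)
have : 0 <= \sum_(i < n) (tnth x i * b - tnth y i * s) ^+ 2.
  by apply: sumr_ge0 => i _; rewrite sqr_ge0.
have -> : \sum_(i < n) (tnth x i * b - tnth y i * s) ^+ 2 = b * (a * b - s ^+ 2).
  transitivity (b ^+ 2 * a - (2 * b * s) * s + s ^+ 2 * b); last by ring.
  have -> : b ^+ 2 * a = \sum_(i < n) b ^+ 2 * tnth x i ^+ 2.
    by rewrite /a sqr_enorm mulr_sumr.
  have -> : 2 * b * s * s = \sum_(i < n) 2 * b * s * (tnth x i * tnth y i).
    by rewrite -mulr_sumr.
  have -> : s ^+ 2 * b = \sum_(i < n) s ^+ 2 * tnth y i ^+ 2.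
    by rewrite /b sqr_enorm mulr_sumr.
  by rewrite -sumrN -!big_split /=; apply: eq_bigr => i _; ring.
have [b_gt0|] := ltrP 0 b; first by rewrite pmulr_rge0 // subr_ge0.
move=> ble0 _; have {}b0 : b = 0 by apply/le_anti; rewrite ble0 b0.
suff -> : s = 0 by rewrite expr0n /= b0 mulr0.
rewrite /s /vdot big1 // => i _.
move: b0; rewrite /b sqr_enorm => /eqP; rewrite psumr_eq0; last by move=> j _; rewrite sqr_ge0.
by move=> /allP /(_ i (mem_index_enum _)) /=; rewrite sqrf_eq0 => /eqP ->; rewrite mulr0.
Qed.

Lemma vdot_le x y : `|vdot x y| <= enorm x * enorm y.
Proof.
rewrite -(ler_pXn2r (_ : 0 < 2)%N) // ?nnegrE ?mulr_ge0 ?enorm_ge0 //.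
by rewrite real_normK ?num_real // exprMn vdot_sqr_le.
Qed.

Lemma vdotC x y : vdot x y = vdot y x.
Proof. by apply: eq_bigr => i _; rewrite mulrC. Qed.

Lemma vdotDl x y z : vdot (vadd x y) z = vdot x z + vdot y z.
Proof. by rewrite /vdot -big_split /=; apply: eq_bigr => i _; rewrite tnthE mulrDl. Qed.

Lemma vdotBl x y z : vdot (vsub x y) z = vdot x z - vdot y z.
Proof. by rewrite /vdot -sumrB; apply: eq_bigr => i _; rewrite tnthE mulrBl. Qed.

Lemma vdotZl t x z : vdot (vscale t x) z = t * vdot x z.
Proof. by rewrite /vdot mulr_sumr; apply: eq_bigr => i _; rewrite tnthE mulrA. Qed.

Lemma vdotZr t x z : vdot z (vscale t x) = t * vdot z x.
Proof. by rewrite vdotC vdotZl vdotC. Qed.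

Lemma enormD x y : enorm (vadd x y) <= enorm x + enorm y.
Proof.
rewrite -(ler_pXn2r (_ : 0 < 2)%N) // ?nnegrE ?addr_ge0 ?enorm_ge0 //.
rewrite enorm_dot vdotDl 2!(vdotC _ (vadd _ _)) !vdotDl -!enorm_dot (vdotC y x).
have := ler_norm (vdot x y); have := vdot_le x y.
rewrite sqrrD mulr2n; lra.
Qed.

Lemma enormZ t x : enorm (vscale t x) = `|t| * enorm x.
Proof.
rewrite /enorm -sqrtr_sqr -sqrtrM ?sqr_ge0 // mulr_sumr.
by congr Num.sqrt; apply: eq_bigr => i _; rewrite tnthE exprMn.
Qed.

Lemma vdistC x y : enorm (vsub x y) = enorm (vsub y x).
Proof.
have -> : vsub x y = vscale (-1) (vsub y x).
  by apply: eq_from_tnth => i; rewrite !tnthE; ring.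
by rewrite enormZ normrN1 mul1r.
Qed.

Lemma vdist_triangle y x z :
  enorm (vsub x z) <= enorm (vsub x y) + enorm (vsub y z).
Proof.
have -> : vsub x z = vadd (vsub x y) (vsub y z).
  by apply: eq_from_tnth => i; rewrite !tnthE; ring.
exact: enormD.
Qed.

Lemma vdistxx x : enorm (vsub x x) = 0.
Proof.
by rewrite /enorm big1 ?sqrtr0 // => i _; rewrite tnthE subrr expr0n.
Qed.

Lemma vdist_gt0 x y : x != y -> 0 < enorm (vsub x y).
Proof.
move=> xy; rewrite lt_neqAle enorm_ge0 andbT; apply: contra xy => /eqP d0.
have : \sum_(i < n) tnth (vsub x y) i ^+ 2 == 0 by rewrite -sqr_enorm -d0 expr0n.
rewrite psumr_eq0; last by move=> j _; rewrite sqr_ge0.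
move=> /allP d; apply/eqP/eq_from_tnth => i.
by have := d i (mem_index_enum _) => /=; rewrite sqrf_eq0 tnthE subr_eq0 => /eqP.
Qed.

Lemma vdist_line a u (s t : R) :
  enorm (vsub (vadd a (vscale s u)) (vadd a (vscale t u))) = `|s - t| * enorm u.
Proof.
have -> : vsub (vadd a (vscale s u)) (vadd a (vscale t u)) = vscale (s - t) u.
  by apply: eq_from_tnth => i; rewrite !tnthE; ring.
exact: enormZ.
Qed.

Lemma vdist_contract a (t : R) x y :
  enorm (vsub (vadd a (vscale t x)) (vadd a (vscale t y))) =
  `|t| * enorm (vsub x y).
Proof.
have -> : vsub (vadd a (vscale t x)) (vadd a (vscale t y)) = vscale t (vsub x y).
  by apply: eq_from_tnth => i; rewrite !tnthE; ring.
exact: enormZ.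
Qed.

Lemma packing_size_le (eta : R) (A : set (n.-tuple R)) S :
  packing eta A S -> ((size S)%:R%:E <= packing_number eta A)%E.
Proof. by move=> pS; apply: ereal_sup_ubound; exists S. Qed.

Lemma packing_le_Mloc (K : set (n.-tuple R)) (eta c : R) nu S : K nu ->
  packing (eta / c) (cball nu eta `&` K) S -> ((size S)%:R%:E <= Mloc K eta c)%E.
Proof.
move=> Knu pS; apply: le_trans (packing_size_le pS) _.
by apply: ereal_sup_ubound; exists nu.
Qed.

(** Greedy selection. The alternative [x = y] keeps the covering true for negative [rho], where no
    point is within [rho] of itself. *)
Lemma exists_max_subpacking (rho : R) (S : seq (n.-tuple R)) :
  exists T, [/\ uniq T, {subset T <= S},
    (forall x y, x \in T -> y \in T -> x != y -> rho < enorm (vsub x y)) &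
    forall x, x \in S -> exists2 y, y \in T & enorm (vsub x y) <= rho \/ x = y].
Proof.
elim: S => [|a S [T [uT sT pT cT]]]; first by exists [::].
have [/hasP[b bT ab]|/hasPn far] := boolP (has (fun b => (enorm (vsub a b) <= rho) || (a == b)) T).
  exists T; split => //; first by move=> x /sT xS; rewrite inE xS orbT.
  move=> x; rewrite inE => /orP[/eqP ->|/cT//].
  by exists b => //; case/orP: ab => [->|/eqP ->]; [left|right].
exists (a :: T); split.
- by rewrite /= uT andbT; apply/negP => /far; rewrite eqxx orbT.
- move=> x; rewrite !inE => /orP[->//|/sT ->]; exact: orbT.
- move=> x y; rewrite !inE => /orP[/eqP ->|xT] /orP[/eqP ->|yT] //; rewrite ?eqxx // => xy.
  + by have := far y yT; rewrite negb_or -ltNge => /andP[].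
  + by have := far x xT; rewrite negb_or -ltNge vdistC => /andP[].
  + exact: pT.
- move=> x; rewrite inE => /orP[/eqP ->|/cT[y yT h]].
  + by exists a; [rewrite mem_head|right].
  + by exists y => //; rewrite inE yT orbT.
Qed.

(* Iterating the local entropy bound: an [eta]-packing of a ball of radius
   [eta * c ^ (k-1)] is refined [k] times by the factor [c]; at radius
   [eta / c] it has at most one point. *)
Lemma packing_iter (K : set (n.-tuple R)) (eta c Q : R) :
  0 < eta -> 2 <= c ->
  (forall s, eta <= s -> (Mloc K s c <= Q%:E)%E) ->
  forall k nu S, K nu -> packing eta (cball nu (eta * c ^+ k / c) `&` K) S ->
  (size S)%:R <= Q ^+ k.
Proof.
move=> eta0 c2 MQ; have c0 : 0 < c by lra.
elim=> [|k IH] nu S Knu [uS [SB pS]].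
  rewrite expr0 -[1]/(1%:R) ler_nat.
  case: S uS SB pS => [//|x [//|y S]] /= /andP[+ _] SB pS.
  rewrite inE negb_or => /andP[xy _].
  have xb : enorm (vsub x nu) <= eta * c ^+ 0 / c by have /= [] := SB x (mem_head _ _).
  have yb : enorm (vsub y nu) <= eta * c ^+ 0 / c.
    by have /= [] := SB y; rewrite ?inE ?eqxx ?orbT.
  have := pS x y; rewrite !inE !eqxx orbT => /(_ isT isT xy).
  have := vdist_triangle nu x y; rewrite (vdistC nu y).
  have : eta * c ^+ 0 / c <= eta / 2.
    by rewrite expr0 mulr1 ler_pM2l // lef_pV2 ?posrE //; lra.
  move: xb yb; set u := eta * _ / c; lra.
have rE : eta * c ^+ k.+1 / c = eta * c ^+ k.
  by rewrite exprS; field; apply/lt0r_neq0.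
rewrite rE in SB.
have [T [uT TS pT cT]] := exists_max_subpacking (eta * c ^+ k / c) S.
have etak : eta <= eta * c ^+ k by apply: ler_peMr; [exact: ltW|apply: exprn_ege1; lra].
have sT : (size T)%:R <= Q.
  have := @packing_le_Mloc K (eta * c ^+ k) c nu T Knu.
  move=> /(_ (conj uT (conj (fun x xT => SB x (TS x xT)) pT))) /le_trans.
  by move=> /(_ _ (MQ _ etak)); rewrite lee_fin.
pose r := fun x y : n.-tuple R => (enorm (vsub x y) <= eta * c ^+ k / c).
have cov x : x \in S -> exists2 y, y \in T & r x y.
  move=> /cT[y yT [h|->]]; first by exists y.
  exists y => //; rewrite /r vdistxx; apply: divr_ge0; last exact: ltW.
  by apply: mulr_ge0; [exact: ltW|exact/exprn_ge0/ltW].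
have Q0 : 0 <= Q by apply: le_trans sT; exact: ler0n.
have := size_le_sum_cover cov; rewrite -(ler_nat R) => /le_trans; apply.
apply: (@le_trans _ _ (\sum_(y <- T) Q ^+ k)); last first.
  by rewrite big_const_seq count_predT iter_addr_0 -mulr_natl exprS ler_wpM2r // exprn_ge0.
rewrite natr_sum big_seq [leRHS]big_seq; apply: ler_sum => y yT.
apply: (IH y); first by have [] := SB y (TS y yT).
split; first exact: filter_uniq.
split=> [x|x x'].
  by rewrite mem_filter => /andP[rxy xS]; split => //; have [] := SB x xS.
by rewrite !mem_filter => /andP[_ xS] /andP[_ x'S]; exact: pS.
Qed.

End Euclid.

(** * Packings of star-shaped unbounded sets *)

Section StarShaped.
Context {R : realType} {n : nat}.
Variable K : set (n.-tuple R).

(** One point of [K] further than [rho] from the star centre yields the segment. The direction [u]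
    depends on [rho], which is harmless since each use concerns a single scale. *)
Lemma star_unbounded_ray : star_shapedE K -> ~ bounded_eucl K ->
  exists2 a, K a & forall rho, 0 < rho -> exists2 u : n.-tuple R, enorm u = 1 &
    forall s, 0 <= s <= rho -> K (vadd a (vscale s u)).
Proof.
move=> [a Ka st] ub; exists a => // rho rho0.
have [k Kk hk] : exists2 k, K k & rho < enorm (vsub k a).
  apply: contrapT => h; apply: ub; exists (rho + enorm a) => x Kx.
  have -> : x = vadd (vsub x a) a by apply: eq_from_tnth => i; rewrite !tnthE; ring.
  apply: le_trans (enormD _ _) _; rewrite lerD2r leNgt.
  by apply/negP => hx; apply: h; exists x.
have d0 : 0 < enorm (vsub k a) by apply: lt_trans hk.
exists (vscale (enorm (vsub k a))^-1 (vsub k a)).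
  by rewrite enormZ gtr0_norm ?invr_gt0 // mulVf // gt_eqF.
move=> s /andP[s0 s1].
have -> : vadd a (vscale s (vscale (enorm (vsub k a))^-1 (vsub k a))) =
  vadd (vscale (1 - s / enorm (vsub k a)) a) (vscale (s / enorm (vsub k a)) k).
  by apply: eq_from_tnth => i; rewrite !tnthE; ring.
apply: st => //; rewrite divr_ge0 ?enorm_ge0 //= ler_pdivrMr // mul1r.
exact: le_trans s1 (ltW hk).
Qed.

(** The homothety of ratio [s / r] about the star centre maps [K] into itself and carries packings
    at scale [r] to packings at scale [s]. *)
Lemma Mloc_nonincreasing (c s r : R) : star_shapedE K -> 0 < c -> 0 < s -> s <= r ->
  (Mloc K r c <= Mloc K s c)%E.
Proof.
move=> [a Ka st] c0 s0 sr; have r0 : 0 < r by apply: lt_le_trans sr.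
set t := s / r; have t0 : 0 < t by rewrite divr_gt0.
have t1 : t <= 1 by rewrite ler_pdivrMr // mul1r.
have tr : t * r = s by rewrite /t divfK // gt_eqF.
pose f x := vadd (vscale (1 - t) a) (vscale t x).
have fK x : K x -> K (f x) by move=> Kx; apply: st => //; rewrite ltW.
have fD x y : enorm (vsub (f x) (f y)) = t * enorm (vsub x y).
  by rewrite vdist_contract gtr0_norm.
have finj : injective f.
  move=> x y fxy; apply/eqP; rewrite -[_ == _]negbK; apply/negP => /vdist_gt0.
  by rewrite -(pmulr_rgt0 _ t0) -fD fxy vdistxx ltxx.
apply: ge_ereal_sup => _ [nu Knu <-]; apply: ge_ereal_sup => _ [S [uS [SB pS]] <-].
rewrite -(size_map f S); apply: (@packing_le_Mloc _ _ _ _ _ (f nu)); first exact: fK.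
split; first by rewrite map_inj_uniq.
split=> [_ /mapP[x /SB[xb Kx] ->]|_ _ /mapP[x xS ->] /mapP[y yS ->]].
  by split; [rewrite /cball /= fD -tr ler_pM2l|exact: fK].
by rewrite (inj_eq finj) fD => xy; rewrite -tr -mulrA ltr_pM2l // pS.
Qed.

(** Sixteen collinear points with gap [2 * (r / c)] span [30 * (r / c)], which fits in radius [r]
    once [c >= 32]: hence the threshold for [c]. The number 16 is dictated by the second moment
    argument, which needs a packing of more than 8 points. *)
Lemma Mloc_ge16 (c r : R) : star_shapedE K -> ~ bounded_eucl K ->
  32 <= c -> 0 < r -> (16%:E <= Mloc K r c)%E.
Proof.
move=> st ub c32 r0; have [a Ka /(_ r r0)[u u1 Ku]] := star_unbounded_ray st ub.
pose f (i : nat) := vadd a (vscale (i%:R * (2 * (r / c))) u).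
have rc0 : 0 < r / c by rewrite divr_gt0 //; lra.
have rc : 32 * (r / c) <= r.
  by rewrite mulrA ler_pdivrMr ?(mulrC r) ?ler_pM2r //; lra.
have fD i j : enorm (vsub (f i) (f j)) = `|i%:R - j%:R| * (2 * (r / c)).
  by rewrite vdist_line u1 mulr1 -mulrBl normrM [X in _ * X]ger0_norm //; lra.
have fsep i j : (i != j)%N -> r / c < enorm (vsub (f i) (f j)).
  move=> ij; rewrite fD; suff : 1 <= `|i%:R - j%:R : R|.
    move=> h; have := ler_wpM2r (ltW rc0) h; lra.
  have near k l : (k < l)%N -> 1 <= `|k%:R - l%:R : R|.
    by move=> kl; rewrite distrC -natrB ?(ltnW kl) // normr_nat ler1n subn_gt0.
  by case: ltngtP ij => // [/near //|/near]; rewrite distrC.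
have finj : injective f.
  move=> i j fij; apply/eqP; rewrite -[_ == _]negbK; apply/negP => /fsep.
  by rewrite fij vdistxx ltNge ltW.
have -> : 16 = (size (map f (iota 0 16)))%:R :> R by rewrite size_map size_iota.
have f0 : f 0%N = a by apply: eq_from_tnth => i; rewrite !tnthE; ring.
apply: (@packing_le_Mloc _ _ _ _ _ a) => //; split.
  by rewrite map_inj_uniq // iota_uniq.
split=> [_ /mapP[i + ->]|_ _ /mapP[i _ ->] /mapP[j _ ->]]; last first.
  by rewrite (inj_eq finj) => /fsep.
rewrite mem_iota => /andP[_ i16].
have i15 : (i%:R : R) <= 15 by rewrite (ler_nat R i 15) -ltnS.
have ir : i%:R * (2 * (r / c)) <= r.
  by have := ler_wpM2r (ltW rc0) i15; lra.
split; last by apply: Ku; rewrite ir andbT mulr_ge0 //; lra.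
by rewrite /cball /= -[X in vsub _ X]f0 fD subr0 normr_nat.
Qed.

(** A maximal packing can be infinite, so Zorn's lemma replaces the greedy choice; maximality makes
    it an [eta]-net. *)
Lemma exists_max_packing_set (eta : R) :
  exists G : set (n.-tuple R), [/\ G `<=` K,
    (forall x y, G x -> G y -> x != y -> eta < enorm (vsub x y)) &
    forall x, K x -> exists2 g, G g & x = g \/ enorm (vsub x g) <= eta].
Proof.
pose P (G : set (n.-tuple R)) := G `<=` K /\
  (forall x y, G x -> G y -> x != y -> eta < enorm (vsub x y)).
have [F FP tF|G [[GK pG] mG]] := @Zorn_bigcup _ P.
  split=> [x [A FA Ax]|x y [A FA Ax] [B FB By] xy]; first by have [AK _] := FP _ FA; exact: AK.
  have [AB|BA] := tF _ _ FA FB.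
    by have [_ pB] := FP _ FB; apply: pB => //; exact: AB.
  by have [_ pA] := FP _ FA; apply: pA => //; exact: BA.
exists G; split => // x Kx; apply: contrapT => h.
have far g : G g -> eta < enorm (vsub x g).
  by move=> Gg; rewrite ltNge; apply/negP => hg; apply: h; exists g => //; right.
apply: (mG (G `|` [set x])); first split.
- by move=> y; left.
- by move=> /(_ x (or_intror erefl)) Gx; apply: h; exists x => //; left.
- split=> [y [/GK//|->//]|y z [Gy|->] [Gz|->]]; rewrite ?eqxx // => yz.
  + exact: pG.
  + by rewrite vdistC; exact: far.
  + exact: far.
Qed.

Lemma finite_packing_set (eta : R) (A G : set (n.-tuple R)) (b : R) :
  G `<=` A -> (forall x y, G x -> G y -> x != y -> eta < enorm (vsub x y)) ->
  (forall S, packing eta A S -> (size S)%:R <= b) -> finite_set G.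
Proof.
move=> GA pG hb; apply: contrapT => /(infinite_set_fset (Num.bound `|b|).+1)[B BG cB].
have := hb B; apply/not_implyP; split; last first.
  apply/negP; rewrite -ltNge; apply: (@lt_trans _ _ (Num.bound `|b|)%:R).
    by apply: le_lt_trans (ler_norm _) _; exact: archi_boundP.
  by rewrite ltr_nat (leq_trans _ cB).
split; first exact: fset_uniq.
by split=> [x xB|x y xB yB]; [exact/GA/BG|apply: pG; exact: BG].
Qed.

(** Countability makes the estimator a choice among countably many values, hence measurable. The
    enumeration may repeat points. *)
Lemma exists_enum_of_bounded_finite (G : set (n.-tuple R)) a : G a ->
  (forall r, finite_set (G `&` cball a r)) ->
  exists e : nat -> n.-tuple R, range e = G.
Proof.
move=> Ga fG.
have cG : countable G.
  have -> : G = \bigcup_(k in [set: nat]) (G `&` cball a k%:R).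
    apply/seteqP; split=> [x Gx|x [k _ []//]].
    exists (Num.bound (enorm (vsub x a))) => //; split => //.
    by rewrite /cball /=; apply: ltW; apply: archi_boundP; exact: enorm_ge0.
  by apply: bigcup_countable => // k _; exact: finite_set_countable.
have /pfcard_geP[G0|/surjfunPex[e eG]] := cG.
  by move: Ga; rewrite G0.
by exists e.
Qed.
End StarShaped.

(** * Independent products and exponential moments *)

Section IndependentProduct.
Import HBNNSimple.
Context {R : realType} {d d' : measure_display}.
Context {Omega : measurableType d} {T : measurableType d'}.
Variable P : probability Omega R.

(** The passage from indicators to simple functions to monotone limits, with [F] kept as a weight.
    Finiteness of [q] lets multiplication by [q] commute with the limit. *)
Lemma ge0_integral_mul_of_indic (X : Omega -> T) (F : Omega -> R) (q : \bar R) :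
  measurable_fun setT X -> measurable_fun setT F ->
  (forall w, 0 <= F w) -> (0 <= q)%E -> q \is a fin_num ->
  (forall B, measurable B ->
    \int[P]_w (\1_B (X w) * F w)%:E = (P (X @^-1` B) * q))%E ->
  forall f : T -> R, measurable_fun setT f -> (forall x, 0 <= f x) ->
  (\int[P]_w (f (X w) * F w)%:E = (\int[P]_w (f (X w))%:E) * q)%E.
Proof.
move=> mX mF F0 q0 qfin Hind f mf f0.
have mef : measurable_fun setT (EFin \o f : T -> \bar R) by exact/measurable_EFinP.
pose h := nnsfun_approx measurableT mef.
have h0 n x : 0 <= h n x by [].
have mhX n : measurable_fun setT (fun w => h n (X w)).
  by apply: measurableT_comp.
have cvh x : EFin \o h^~ x @ \oo --> (f x)%:E.
  by apply: (@cvg_nnsfun_approx _ _ _ setT measurableT _ mef) => // y _; rewrite lee_fin.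
have ndh x a b : (a <= b)%N -> h a x <= h b x.
  by move=> ab; exact/lefP/nd_nnsfun_approx.
have step n : (\int[P]_w (h n (X w) * F w)%:E = (\int[P]_w (h n (X w))%:E) * q)%E.
  pose s := fset_set (range (h n)).
  pose B (i : 'I_(#|` s|)) := h n @^-1` [set s`_i].
  have mB i : measurable (B i) by exact: measurable_sfunP.
  have s0 (i : 'I_(#|` s|)) : 0 <= s`_i.
    have : s`_i \in s by rewrite mem_nth.
    by rewrite in_fset_set // inE => -[x _ <-].
  have hE x : h n x = \sum_(i < #|` s|) s`_i * \1_(B i) x by rewrite (fimfunEord (h n)).
  have m1 i : measurable_fun setT (fun w => \1_(B i) (X w) : R).
    by apply: measurableT_comp => //.
  transitivity (\sum_(i < #|` s|) ((s`_i)%:E * \int[P]_w (\1_(B i) (X w) * F w)%:E))%E.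
    transitivity (\int[P]_w \sum_(i < #|` s|) ((s`_i)%:E * (\1_(B i) (X w) * F w)%:E))%E.
      apply: eq_integral => w _; rewrite hE mulr_suml -sumEFin.
      by apply: eq_bigr => i _; rewrite -mulrA EFinM.
    rewrite ge0_integral_sum //=.
    - apply: eq_bigr => i _; rewrite ge0_integralZl ?lee_fin //.
        by apply/measurable_EFinP; exact: measurable_funM.
      by move=> w _; rewrite lee_fin mulr_ge0.
    - move=> i; apply/measurable_EFinP; apply: measurable_funM => //.
      exact: measurable_funM.
    - by move=> i w _; rewrite lee_fin !mulr_ge0.
  transitivity ((\sum_(i < #|` s|) ((s`_i)%:E * P (X @^-1` B i))) * q)%E; last first.
    congr (_ * q)%E.
    transitivity (\int[P]_w \sum_(i < #|` s|) ((s`_i)%:E * (\1_(B i) (X w))%:E))%E; last first.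
      by apply: eq_integral => w _; rewrite hE -sumEFin; apply: eq_bigr.
    rewrite ge0_integral_sum //=.
    - apply: eq_bigr => i _; rewrite ge0_integralZl ?lee_fin //; last first.
        by apply/measurable_EFinP.
      congr (_ * _)%E; rewrite -[in LHS](setIT (_ @^-1` _)) -integral_indic //.
      by rewrite -[X in d.-measurable X]setTI; exact: mX.
    - by move=> i; apply/measurable_EFinP; exact: measurable_funM.
    - by move=> i w _; rewrite lee_fin mulr_ge0.
  rewrite ge0_sume_distrl; last by move=> i _; rewrite mule_ge0 // lee_fin.
  by apply: eq_bigr => i _; rewrite Hind // muleA.
transitivity (limn (fun n => \int[P]_w (h n (X w) * F w)%:E))%E.
  rewrite -monotone_convergence //.
  - apply: eq_integral => w _; apply/esym/cvg_lim => //.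
    by under eq_fun do rewrite EFinM; rewrite EFinM; apply: cvgeZr => //; exact: cvh.
  - by move=> n; apply/measurable_EFinP; exact: measurable_funM.
  - by move=> n w _; rewrite lee_fin mulr_ge0.
  - by move=> w _ a b ab; rewrite lee_fin ler_wpM2r // ndh.
under eq_fun do rewrite step.
have cvI : (\int[P]_w (h n (X w))%:E @[n --> \oo] --> \int[P]_w (f (X w))%:E)%E.
  have -> : (\int[P]_w (f (X w))%:E = \int[P]_w limn (fun n => (h n (X w))%:E))%E.
    by apply: eq_integral => w _; apply/esym/cvg_lim => //; exact: cvh.
  apply: cvg_monotone_convergence => //.
  - by move=> n; apply/measurable_EFinP.
  - by move=> n w _; rewrite lee_fin.
  - by move=> w _ a b ab; rewrite lee_fin ndh.
by apply/cvg_lim => //; exact: cvgeZr.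
Qed.

Lemma prod_indic N (X : 'I_N -> Omega -> T) (B : 'I_N -> set T) w :
  \prod_(i < N) (\1_(B i) (X i w) : R) =
  \1_(\bigcap_(i in [set: 'I_N]) (X i @^-1` B i)) w.
Proof.
rewrite [RHS]indicE; have [wB|wB] := boolP (w \in _).
  by rewrite big1 // => i _; move: wB; rewrite inE => /(_ i I) /= Bi; rewrite indicE mem_set.
have [i Bi] : exists i, ~ B i (X i w).
  by apply/not_existsP => h; move/negP: wB; apply; rewrite inE => i _; exact: contrapT (h i).
by rewrite (bigD1 i) //= indicE memNset // mul0r.
Qed.

Section Family.
Context {N : nat}.
Variable xi : 'I_N -> Omega -> T.
Hypothesis mxi : forall i, measurable_fun setT (xi i).
Hypothesis indep_xi : forall B : 'I_N -> set T, (forall i, measurable (B i)) ->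
  P (\bigcap_(i in [set: 'I_N]) (xi i @^-1` B i)) =
  (\prod_(i < N) P (xi i @^-1` B i))%E.

Let mpre i B : measurable B -> measurable (xi i @^-1` B).
Proof. by move=> mB; rewrite -[X in d.-measurable X]setTI; exact: mxi. Qed.

Lemma integral_indic_comp i (B : set T) : measurable B ->
  (\int[P]_w (\1_B (xi i w))%:E = P (xi i @^-1` B))%E.
Proof.
by move=> mB; rewrite -[in RHS](setIT (_ @^-1` _)) -integral_indic //; exact: mpre.
Qed.

Lemma ge0_integral_prod_indep (f : 'I_N -> T -> R) :
  (forall i, measurable_fun setT (f i)) -> (forall i x, 0 <= f i x) ->
  (forall i, (\int[P]_w (f i (xi i w))%:E < +oo)%E) ->
  (\int[P]_w (\prod_(i < N) f i (xi i w))%:E =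
   \prod_(i < N) \int[P]_w (f i (xi i w))%:E)%E.
Proof.
(* Induction on the number [k] of factors allowed to be arbitrary, the others being indicators. For
   [k = 0] this is the independence hypothesis. *)
suff H (k : nat) : (k <= N)%N -> forall g : 'I_N -> T -> R,
  (forall i, measurable_fun setT (g i)) -> (forall i x, 0 <= g i x) ->
  (forall i, (\int[P]_w (g i (xi i w))%:E < +oo)%E) ->
  (forall i : 'I_N, (k <= i)%N -> exists2 B, measurable B & g i = \1_B) ->
  (\int[P]_w (\prod_(i < N) g i (xi i w))%:E =
   \prod_(i < N) \int[P]_w (g i (xi i w))%:E)%E.
  move=> mf f0 ff; apply: (H N) => // i; by rewrite leqNgt ltn_ord.
elim: k => [|k IH] kN g mg g0 gfin gB.
  have /choice[B HB] : forall i, exists B, measurable B /\ g i = \1_B.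
    by move=> i; have [B mB gE] := gB i (leq0n i); exists B.
  under eq_integral do under eq_bigr do rewrite (HB _).2.
  under eq_integral do rewrite prod_indic.
  rewrite integral_indic //; last first.
    apply: fin_bigcap_measurable => //.
    by move=> i _; apply: mpre; have [] := HB i.
  rewrite setIT; apply: etrans (indep_xi _) _; first by move=> i; have [] := HB i.
  by apply: eq_bigr => i _; rewrite (HB i).2 integral_indic_comp //; have [] := HB i.
pose i0 := Ordinal kN.
have gint0 i : (0 <= \int[P]_w (g i (xi i w))%:E)%E.
  by apply: integral_ge0 => w _; rewrite lee_fin.
have gifin i : (\int[P]_w (g i (xi i w))%:E \is a fin_num)%E.
  by rewrite ge0_fin_numE.
pose F w := \prod_(i < N | i != i0) g i (xi i w).
pose q := (\prod_(i < N | i != i0) \int[P]_w (g i (xi i w))%:E)%E.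
have -> : (\int[P]_w (\prod_(i < N) g i (xi i w))%:E =
    \int[P]_w (g i0 (xi i0 w) * F w)%:E)%E.
  by apply: eq_integral => w _; rewrite (bigD1 i0).
rewrite (bigD1 i0) //= -/q.
apply: ge0_integral_mul_of_indic => //.
- rewrite /F; under eq_fun do rewrite big_mkcond /=.
  by apply: measurable_prod => i _; case: (i != i0) => //; apply: measurableT_comp.
- by move=> w; apply: prodr_ge0.
- by apply: prode_ge0.
- by apply: prode_fin_num.
(* Trading factor [i0] for an indicator leaves [k] arbitrary factors, so the induction hypothesis
   applies. *)
move=> B mB; pose g' i := if i == i0 then \1_B else g i.
have := IH (ltnW kN) g'; rewrite (bigD1 i0) //= /g' eqxx integral_indic_comp //.
rewrite (eq_bigr (fun i => \int[P]_w (g i (xi i w))%:E)%E); last first.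
  by move=> i /negPf ->.
rewrite -/q => <-.
- apply: eq_integral => w _; rewrite [in RHS](bigD1 i0) //= eqxx; congr (_ * _)%:E.
  by apply: eq_bigr => i /negPf ->.
- by move=> i; case: ifP => // _.
- by move=> i x; case: ifP => // _.
- move=> i; case: ifP => // /eqP ->; rewrite integral_indic_comp //.
  by rewrite (le_lt_trans (probability_le1 _ _)) ?ltry //; exact: mpre.
- move=> i ki; case: ifPn => [_|ii0]; first by exists B.
  apply: gB; rewrite ltn_neqAle ki andbT; apply: contra ii0 => /eqP ki0.
  exact/eqP/val_inj.
Qed.

End Family.

End IndependentProduct.

Section RintegralSum.
Context {R : realType} {d : measure_display} {Omega : measurableType d}.
Variable P : probability Omega R.
Local Notation integrable f := (P.-integrable setT (EFin \o f)).

Lemma integrable_sumr (I : Type) (s : seq I) (f : I -> Omega -> R) :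
  (forall i, integrable (f i)) -> integrable (fun w => \sum_(i <- s) f i w).
Proof.
move=> intf; have : P.-integrable setT (fun w => (\sum_(i <- s) (f i w)%:E)%E).
  by apply: integrable_sum => // i _; exact: intf.
by apply: eq_integrable => // w _; rewrite /= sumEFin.
Qed.

Lemma Rintegral_sum (I : Type) (s : seq I) (f : I -> Omega -> R) :
  (forall i, integrable (f i)) ->
  (\int[P]_w (\sum_(i <- s) f i w)) = \sum_(i <- s) \int[P]_w f i w.
Proof.
move=> intf; elim: s => [|i s IH].
  by rewrite big_nil; under eq_Rintegral do rewrite big_nil; rewrite Rintegral_cst // mul0r.
rewrite big_cons -IH -RintegralD //; last exact: integrable_sumr.
by apply: eq_Rintegral => w _; rewrite big_cons.
Qed.

Lemma integrableZr_real (r : R) f : integrable f -> integrable (fun w => f w * r).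
Proof.
move=> intf; have := integrableZr measurableT r intf.
by apply: eq_integrable.
Qed.

End RintegralSum.

(** * Exponential moments from two moments *)

Section Moments.
Context {R : realType} {n : nat} {d : measure_display} {Omega : measurableType d}.
Variable P : probability Omega R.
Local Notation integrable f := (P.-integrable setT (EFin \o f)).
Variables (sigma : R) (X : Omega -> n.-tuple R).
Hypothesis XiX : in_Xi P sigma X.

Lemma in_Xi_measurable_vdot u : measurable_fun setT (fun w => vdot (X w) u).
Proof.
have [mX _] := XiX; apply: measurable_sum => i.
apply: measurable_funM => //.
exact: (measurable_fun_tnthP _).1.
Qed.

Lemma in_Xi_integrable_coordM i j : integrable (fun w => Defs.coord X i w * Defs.coord X j w).
Proof.
have [mX [_ [i2 _]]] := XiX.
have mc k : measurable_fun setT (Defs.coord X k) by exact: (measurable_fun_tnthP _).1.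
apply: (@le_integrable _ _ _ _ _ measurableT _
    ((fun w => (Defs.coord X i w ^+ 2)%:E) \+ (fun w => (Defs.coord X j w ^+ 2)%:E))%E) => //.
- by apply/measurable_EFinP; exact: measurable_funM.
- move=> w _; rewrite /= lee_fin normrM.
  set a := Defs.coord X i w; set b := Defs.coord X j w.
  rewrite [leRHS]ger0_norm ?addr_ge0 ?sqr_ge0 //.
  rewrite -(real_normK (num_real a)) -(real_normK (num_real b)).
  have := sqr_ge0 (`|a| - `|b|); have := sqr_ge0 `|a|; have := sqr_ge0 `|b|.
  rewrite sqrrB mulr2n; lra.
- exact: integrableD.
Qed.

Lemma in_Xi_integrable_vdot u : integrable (fun w => vdot (X w) u).
Proof.
have [_ [i1 _]] := XiX; apply: integrable_sumr => i.
exact: (integrableZr_real (tnth u i) (i1 i)).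
Qed.

Lemma in_Xi_mean_coord j : Rintegral P setT (Defs.coord X j) = 0.
Proof.
have [_ [_ [_ [m0 _]]]] := XiX.
by have := congr1 (fun M : 'rV_n => M 0 j) m0; rewrite !mxE.
Qed.

Lemma in_Xi_mean u : \int[P]_w vdot (X w) u = 0.
Proof.
have [_ [i1 [_ [m0 _]]]] := XiX.
rewrite Rintegral_sum; last by move=> i; exact: (integrableZr_real (tnth u i) (i1 i)).
rewrite big1 // => i _; rewrite RintegralZr //; last exact: i1.
by have := in_Xi_mean_coord i; rewrite /Defs.coord => ->; rewrite mul0r.
Qed.

Let sqrE u w : vdot (X w) u ^+ 2 =
  \sum_(i < n) \sum_(j < n) Defs.coord X i w * Defs.coord X j w * (tnth u i * tnth u j).
Proof.
rewrite expr2 {1}/vdot mulr_suml; apply: eq_bigr => i _.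
rewrite /vdot mulr_sumr; apply: eq_bigr => j _; rewrite /Defs.coord; ring.
Qed.

Lemma in_Xi_integrable_vdot2 u : integrable (fun w => vdot (X w) u ^+ 2).
Proof.
have -> : (fun w => vdot (X w) u ^+ 2) = (fun w =>
  \sum_(i < n) \sum_(j < n) Defs.coord X i w * Defs.coord X j w * (tnth u i * tnth u j)).
  by apply/funext => w; rewrite sqrE.
do 2![apply: integrable_sumr => ?].
exact/integrableZr_real/in_Xi_integrable_coordM.
Qed.

Lemma in_Xi_variance u :
  \int[P]_w (vdot (X w) u ^+ 2) <= sigma ^+ 2 * enorm u ^+ 2.
Proof.
have [_ [_ [_ [m0 /(_ (\row_j tnth u j)) cov]]]] := XiX.
have -> : \int[P]_w (vdot (X w) u ^+ 2) =
    \sum_(i < n) \sum_(j < n) (\int[P]_w (Defs.coord X i w * Defs.coord X j w)) * (tnth u i * tnth u j).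
  under eq_Rintegral do rewrite sqrE.
  rewrite Rintegral_sum => [|i].
    apply: eq_bigr => i _; rewrite Rintegral_sum => [|j].
      by apply: eq_bigr => j _; rewrite RintegralZr //; exact: in_Xi_integrable_coordM.
    exact/integrableZr_real/in_Xi_integrable_coordM.
  apply: integrable_sumr => j; exact/integrableZr_real/in_Xi_integrable_coordM.
move: cov; rewrite subr_ge0; congr (_ <= _); last first.
  rewrite mul_mx_scalar -scalemxAl !mxE; congr (_ * _).
  by rewrite sqr_enorm; apply: eq_bigr => i _; rewrite !mxE expr2.
rewrite !mxE exchange_big; apply: eq_bigr => j _; rewrite !mxE mulr_suml.
apply: eq_bigr => i _; rewrite !mxE.
under eq_Rintegral do rewrite !in_Xi_mean_coord !subr0.
ring.
Qed.

(** The linear term has mean zero, so [b] is free and does not enter the bound; the majorant may be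
    expanded around any shift. *)
Lemma in_Xi_exp_moment u (g : R -> R) (a b c : R) :
  measurable_fun setT g -> 0 <= c -> enorm u = 1 ->
  (forall y, expR (g y) <= a + b * y + c * y ^+ 2) ->
  (\int[P]_w (expR (g (vdot (X w) u)))%:E <= (a + c * sigma ^+ 2)%:E)%E.
Proof.
move=> mg c0 u1 hg.
have i1 := in_Xi_integrable_vdot u; have i2 := in_Xi_integrable_vdot2 u.
pose q w := a + vdot (X w) u * b + vdot (X w) u ^+ 2 * c.
have ia : integrable (fun _ => a) by exact: finite_measure_integrable_cst.
have iab : integrable (fun w => a + vdot (X w) u * b).
  by have := integrableD measurableT ia (integrableZr_real b i1); exact: eq_integrable.
have iq : integrable q.
  by have := integrableD measurableT iab (integrableZr_real c i2); exact: eq_integrable.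
apply: (@le_trans _ _ (\int[P]_w (q w)%:E)%E).
  apply: ge0_le_integral => //.
  - apply/measurable_EFinP; apply: measurableT_comp => //.
    by apply: (measurableT_comp mg); exact: in_Xi_measurable_vdot.
  - by have /integrableP[] := iq.
  - by move=> w _; rewrite lee_fin (le_trans (hg _)) // /q; lra.
have -> : (\int[P]_w (q w)%:E)%E = (\int[P]_w q w)%:E.
  by rewrite fineK //; exact: (integrable_fin_num _ iq).
rewrite lee_fin /q RintegralD //; last exact: integrableZr_real.
rewrite RintegralD //; last exact: integrableZr_real.
rewrite !RintegralZr // in_Xi_mean mul0r addr0 Rintegral_cst //.
have -> : fine (P setT) = 1 by rewrite probability_setT.
rewrite mulr1 lerD2l mulrC ler_wpM2l //.
by have := in_Xi_variance u; rewrite u1 expr1n mulr1.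
Qed.

End Moments.

(** * Scores, corruption and the Chernoff bound *)

Section Score.
Context {R : realType} {n N : nat}.

Definition score (g : R -> R) (v u : n.-tuple R) (x : sample R n N) : R :=
  \sum_(i < N) g (vdot (vsub (tnth x i) v) u).

Lemma measurable_score g v u : measurable_fun setT g ->
  measurable_fun setT (score g v u).
Proof.
move=> mg; apply: measurable_sum => i; apply: (measurableT_comp mg).
have -> : (fun x : sample R n N => vdot (vsub (tnth x i) v) u) =
    (fun x => \sum_(j < n) (tnth (tnth x i) j - tnth v j) * tnth u j).
  by apply/funext => x; apply: eq_bigr => j _; rewrite tnthE.
apply: measurable_sum => j; apply: measurable_funM => //.
apply: measurable_funB => //.
apply: (measurableT_comp (measurable_tnth j)).
exact: measurable_tnth.
Qed.

Lemma measurable_score_ge0 g v u : measurable_fun setT g ->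
  measurable [set x | 0 <= score g v u x].
Proof.
move=> /(measurable_score v u) /(_ measurableT _ (measurable_itv `[0, +oo[)).
congr (measurable _); rewrite setTI; apply/seteqP.
by split=> x /=; rewrite in_itv /= andbT.
Qed.

Lemma score_corrupted g (b eps : R) v u (C : sample R n N -> sample R n N) x :
  (forall y, `|g y| <= b) -> adversary eps C ->
  score g v u (C x) <= score g v u x + 2 * b * eps * N%:R.
Proof.
move=> gb [_ /(_ x) hC]; rewrite -lerBlDl /score -sumrB.
have b0 : 0 <= b := le_trans (normr_ge0 _) (gb 0).
apply: (@le_trans _ _ (\sum_(i < N | tnth (C x) i != tnth x i) 2 * b)); last first.
  rewrite sumr_const -[leLHS]mulr_natr -(mulrA (2 * b)) ler_wpM2l //; lra.
rewrite [leRHS]big_mkcond /=; apply: ler_sum => i _.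
case: eqP => [->|_] /=; first by rewrite subrr.
have := gb (vdot (vsub (tnth (C x) i) v) u).
have := gb (vdot (vsub (tnth x i) v) u).
rewrite !ler_norml => /andP[+ +] /andP[+ +]; lra.
Qed.

End Score.

Section Chernoff.
Context {R : realType} {n N : nat} {d : measure_display} {Omega : measurableType d}.
Variables (P : probability Omega R) (sigma : R) (xi : 'I_N -> Omega -> n.-tuple R).
Hypothesis iid : iid_Xi P sigma xi.

Definition observed (mu : n.-tuple R) (w : Omega) : sample R n N :=
  [tuple vadd mu (xi i w) | i < N].

Lemma measurable_observed mu : measurable_fun setT (observed mu).
Proof.
have [/(_ _)Xi _] := iid.
apply/measurable_fun_tnthP => i.
have -> : (@tnth _ _)^~ i \o observed mu = fun w => vadd mu (xi i w).
  by apply/funext => w; rewrite /= /observed tnth_mktuple.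
apply/measurable_fun_tnthP => j.
have -> : (@tnth _ _)^~ j \o (fun w => vadd mu (xi i w)) =
    fun w => tnth mu j + tnth (xi i w) j.
  by apply/funext => w; rewrite /= tnthE.
apply: measurable_funD => //.
by have [mX _] := Xi i; exact: (measurable_fun_tnthP _).1.
Qed.

(** Markov's inequality for the exponential of the score; the exponent parameter is one because the
    scale of [g] already contains the tuning. Corruption is undone pathwise before independence is
    used, since [C] may mix all observations. *)
Lemma score_tail (mu v u : n.-tuple R) (g : R -> R) (b eps a1 a2 a3 rho : R) C :
  adversary eps C -> measurable_fun setT g -> (forall y, `|g y| <= b) ->
  enorm u = 1 -> 0 <= a3 ->
  (forall y, expR (g (vdot (vsub mu v) u + y)) <= a1 + a2 * y + a3 * y ^+ 2) ->
  a1 + a3 * sigma ^+ 2 <= rho ->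
  (\int[P]_w (\1_[set x | (0 <= score g v u x)%R] (C (observed mu w)))%:E <=
   (expR (2 * b * eps * N%:R) * rho ^+ N)%:E)%E.
Proof.
move=> advC mg gb u1 a30 hg hrho.
have [Xi [_ indep]] := iid.
pose m := vdot (vsub mu v) u.
pose f (z : n.-tuple R) := expR (g (m + vdot z u)).
have mf : measurable_fun setT f.
  apply: measurableT_comp => //; apply: (measurableT_comp mg).
  apply: measurable_funD => //; apply: measurable_sum => i.
  by apply: measurable_funM => //; exact: measurable_tnth.
have scoreE w : score g v u (observed mu w) = \sum_(i < N) g (m + vdot (xi i w) u).
  apply: eq_bigr => i _; congr g; rewrite tnth_mktuple -vdotDl; congr vdot.
  by apply: eq_from_tnth => j; rewrite !tnthE; ring.
have fi i : (\int[P]_w (f (xi i w))%:E <= rho%:E)%E.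
  apply: (@le_trans _ _ (a1 + a3 * sigma ^+ 2)%:E); last by rewrite lee_fin.
  apply: (in_Xi_exp_moment (Xi i)) (u1) (hg) => //.
  by apply: (measurableT_comp mg); exact: measurable_funD.
pose k := expR (2 * b * eps * N%:R).
apply: (@le_trans _ _ (\int[P]_w (k%:E * (\prod_(i < N) f (xi i w))%:E))%E).
  apply: ge0_le_integral => //.
  - apply/measurable_EFinP; apply: measurableT_comp.
      by apply: measurable_indic; exact: measurable_score_ge0.
    by apply: (measurableT_comp advC.1); exact: measurable_observed.
  - apply/measurable_EFinP; apply: measurable_funM => //.
    apply: measurable_prod => i _; apply: (measurableT_comp mf).
    by have [] := Xi i.
  - move=> w _; rewrite -EFinM lee_fin /f -expR_sum -scoreE -expRD indicE.
    case: (boolP (_ \in _)) => [|_]; last exact: expR_ge0.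
    rewrite inE /= => s0; apply: le_trans (expR_ge1Dx _); rewrite lerDl.
    by apply: (le_trans s0); rewrite [leRHS]addrC; exact: score_corrupted.
rewrite ge0_integralZl ?lee_fin ?expR_ge0 //; first last.
- by move=> w _; rewrite lee_fin prodr_ge0 // => i _; exact: expR_ge0.
- apply/measurable_EFinP; apply: measurable_prod => i _; apply: (measurableT_comp mf).
  by have [] := Xi i.
rewrite (ge0_integral_prod_indep (xi := xi) _ indep (f := fun=> f)) //.
- rewrite EFinM lee_wpmul2l // ?lee_fin ?expR_ge0 //.
  rewrite -[N in X in (_ <= X)%E]card_ord -prodr_const -prodEFin.
  have fi0 i : (0 <= \int[P]_w (f (xi i w))%:E)%E.
    by apply: integral_ge0 => w _; rewrite lee_fin expR_ge0.
  suff /andP[] : (0%R <= \prod_(i < N) \int[P]_w (f (xi i w))%:E <=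
     \prod_(i < N) rho%:E)%E by [].
  elim/big_rec2: _ => [|i y x _ /andP[x0 xy]]; first by rewrite lee01 lexx.
  by rewrite mule_ge0 //= lee_pmul.
- by move=> i; have [] := Xi i.
- by move=> i x; exact: expR_ge0.
- by move=> i; apply: le_lt_trans (fi i) _; exact: ltry.
Qed.

End Chernoff.

(** * The robust two-point test *)

Section TestFunction.
Context {R : realType}.
Implicit Types (z y D sigma eps m : R).

Definition clip z : R := if z <= - 2^-1 then - 2^-1 else if 2^-1 <= z then 2^-1 else z.

Lemma clipN z : clip (- z) = - clip z.
Proof. by rewrite /clip; do ![case: lerP => ?]; lra. Qed.

Lemma clip_le z : `|clip z| <= 2^-1.
Proof. 
rewrite /clip; case: (lerP z) => ?; last case: (lerP _ z) => ?;
by rewrite ler_norml; apply/andP; split; lra. Qed.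

Lemma expR_le_geom z : z < 1 -> expR z <= (1 - z)^-1.
Proof.
move=> z1; have h := expR_ge1Dx (- z).
rewrite -[expR z]invrK -expRN lef_pV2 ?posrE ?expR_gt0 ?subr_gt0 //.
Qed.

(** For [z <= 1/2] one has [exp z <= 1 / (1 - z)] and [(1 - z) (1 + z + 2 z^2) = 1 + z^2 (1 - 2 z)
    >= 1], which suggests clipping at [1/2]. Outside the clipping interval the left side is frozen
    while the quadratic grows. *)
Lemma expR_clip_le z : expR (clip z) <= 1 + z + 2 * z ^+ 2.
Proof.
have geom (w : R) : w < 1 -> w ^+ 2 * (1 - 2 * w) >= 0 -> expR w <= 1 + w + 2 * w ^+ 2.
  move=> w1 hw; apply: le_trans (expR_le_geom w1) _.
  rewrite -[leLHS]mul1r ler_pdivrMr ?subr_gt0 //.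
  rewrite !expr2 in hw *; nra.
have [z_lo|z_lo] := lerP z (- 2^-1).
  have -> : clip z = - 2^-1.
    by rewrite /clip; do ![case: lerP => ?]; lra.
  have : expR (- 2^-1 : R) <= 1 + - 2^-1 + 2 * (- 2^-1) ^+ 2.
    by apply: geom; rewrite ?expr2; lra.
  by rewrite !expr2; have : 0 <= (- z) * (- 1 - 2 * z); [apply: mulr_ge0; lra|lra].
have [z_hi|z_hi] := lerP z 2^-1; last first.
  have -> : clip z = 2^-1.
    by rewrite /clip; do ![case: lerP => ?]; lra.
  have : expR (2^-1 : R) <= 1 + 2^-1 + 2 * (2^-1) ^+ 2 by apply: geom; rewrite ?expr2; lra.
  rewrite !expr2; have : 0 <= (z - 2^-1) * (z + 2^-1) by apply: mulr_ge0; lra.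
  by lra.
have -> : clip z = z.
  by rewrite /clip; do ![case: lerP => ?]; lra.
by apply: geom; [lra|rewrite mulr_ge0 ?sqr_ge0 //; lra].
Qed.

(* [kappa = 9 ^ 3], so that [ln 9 <= ln y / 3] for [kappa < y]. *)
Definition kappa : R := 729.
(** Makes [(D / sigma)^2 / tau <= 1/4] whenever [D <= kappa * sigma], so that the second-order terms
    of the exponential stay below the drift. *)
Definition tau : R := 4 * kappa ^+ 2.

(** Near: [1 / tau] times the Gaussian log-likelihood ratio between means [D] and [0], clipped. Far:
    with [y = D / sigma], the factor [ln y] balances the value [1 / y] on the correct side against
    [y] times the Chebyshev probability of order [1 / y^2] on the wrong one. *)
Definition test_fun sigma D y : R :=
  if D <= kappa * sigma then clip (D / (tau * sigma ^+ 2) * (y - D / 2))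
  else ln (D / sigma) * Num.sg (y - D / 2).

(** Error exponent per observation of a duel at normalized distance [y], after paying for the
    corruption. *)
Definition rate y : R := if y <= kappa then y ^+ 2 / (16 * tau) else ln y / 2.

(** Exchanging the two competitors reflects [y] into [D - y]; this oddness makes duels
    antisymmetric. *)
Lemma test_funN sigma D y : test_fun sigma D (D - y) = - test_fun sigma D y.
Proof.
rewrite /test_fun; have -> : D - y - D / 2 = - (y - D / 2) by field.
by case: ifP => _; rewrite ?sgrN mulrN // clipN.
Qed.

Lemma measurable_clip : measurable_fun setT clip.
Proof.
have -> : clip = (fun z => Num.max (- 2^-1) (Num.min 2^-1 z)).
  apply/funext => z; rewrite /clip.
  case: (lerP z) => ?; first by rewrite min_r ?max_l //; lra.
  case: (lerP _ z) => ?; by rewrite max_r //; lra.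
by apply: measurable_maxr => //; exact: measurable_minr.
Qed.

Lemma measurable_test_fun sigma D : measurable_fun setT (test_fun sigma D).
Proof.
have mlin : measurable_fun setT (fun y : R => y - D / 2) by exact: measurable_funB.
rewrite /test_fun; case: (D <= kappa * sigma).
  by apply: (measurableT_comp measurable_clip); exact: measurable_funM.
apply: measurable_funM => //.
have -> : (fun y => Num.sg (y - D / 2)) =
    (fun y => (\1_(`]D / 2, +oo[%classic) y - \1_(`]-oo, D / 2[%classic) y : R)).
  apply/funext => y; rewrite !indicE !mem_setE !in_itv /= andbT.
  by case: (ltgtP (D / 2) y) => h /=;
    [rewrite gtr0_sg ?subr_gt0|rewrite ltr0_sg ?subr_lt0|rewrite h subrr sgr0];
    rewrite ?subr0 ?sub0r ?subrr.
by apply: measurable_funB; exact: measurable_indic.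
Qed.

(** The condition [|m| <= D / 8] leaves the true mean at least [3 D / 8] short of the midpoint
    [D / 2]; both regimes draw their negative drift from this gap. *)
Lemma test_fun_spec sigma D eps :
  0 < sigma -> 0 < D -> 0 < eps -> eps < 1 / 32 ->
  16 * tau * sigma ^+ 2 * eps <= D ^+ 2 ->
  exists2 b, (forall y, `|test_fun sigma D y| <= b) &
    forall m, `|m| <= D / 8 -> exists a1 a2 a3 rho,
    [/\ 0 <= a3, 0 <= rho,
      forall y, expR (test_fun sigma D (m + y)) <= a1 + a2 * y + a3 * y ^+ 2,
      a1 + a3 * sigma ^+ 2 <= rho &
      expR (2 * b * eps) * rho <= expR (- rate (D / sigma))].
Proof.
move=> s0 D0 e0 e32 hD.
have tau0 : 0 < tau by rewrite /tau /kappa; lra.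
have y0 : 0 < D / sigma by rewrite divr_gt0.
rewrite /rate /test_fun -(ler_pdivrMr _ _ s0).
set y := D / sigma in y0 *; have DE : D = y * sigma by rewrite /y divfK // gt_eqF.
case: ifPn => yk.
- exists 2^-1 => [z|m hm]; first exact: clip_le.
  set al := D / (tau * sigma ^+ 2); set w := m - D / 2.
  have al0 : 0 < al by rewrite divr_gt0 // mulr_gt0 // exprn_gt0.
  set u := y ^+ 2 / tau.
  have alD : al * D = u by rewrite /al /u DE; field; rewrite !gt_eqF.
  have als : al ^+ 2 * sigma ^+ 2 = u / tau by rewrite /al /u DE; field; rewrite !gt_eqF.
  have u0 : 0 < u by rewrite divr_gt0 // exprn_gt0.
  have u4 : u <= 1 / 4.
    rewrite ler_pdivrMr // /tau mulrA (_ : 1 / 4 * 4 = 1) ?mul1r; last by field.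
    by rewrite ler_pXn2r // nnegrE ?ltW // /kappa; lra.
  exists (1 + al * w + 2 * (al * w) ^+ 2), (al + 4 * al * (al * w)), (2 * al ^+ 2), (expR (- (u / 8))).
  (* The drift is at most [- 3 u / 8]; the quadratic terms consume less than [u / 4] of it, leaving
     [u / 8]. *)
  have [w1 w2] : - (5/8 * u) <= al * w /\ al * w <= - (3 / 8 * u).
    rewrite -alD; move: hm; rewrite ler_norml => /andP[h1 h2].
    by rewrite /w; split; nra.
  split.
  + by rewrite mulr_ge0 // sqr_ge0.
  + exact: expR_ge0.
  + move=> t; apply: le_trans (expR_clip_le _) _.
    rewrite (_ : al * (m + t - D / 2) = al * w + al * t); last by rewrite /w; ring.
    by rewrite le_eqVlt; apply/orP; left; apply/eqP; ring.
  + apply: le_trans (expR_ge1Dx _).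
    rewrite -(mulrA 2 (al ^+ 2)) als.
    have : u / tau <= u / 100.
      by rewrite ler_pM2l // lef_pV2 ?posrE // /tau /kappa; lra.
    have : (al * w) ^+ 2 <= (5 / 8 * u) ^+ 2.
      by rewrite -[leLHS]sqrrN ler_pXn2r ?nnegrE //; lra.
    rewrite !expr2; nra.
  + rewrite -expRD ler_expR.
    have -> : y ^+ 2 / (16 * tau) = u / 16 by rewrite /u; field; rewrite gt_eqF.
    have -> : 2 * 2^-1 * eps = eps by field.
    (* Half of the exponent [u / 8] pays for the corruption; this is the hypothesis
       [16 tau sigma^2 eps <= D^2]. *)
    suff : eps <= u / 16 by lra.
    rewrite /u -mulrA -invfM ler_pdivlMr ?mulr_gt0 //.
    rewrite -(ler_pM2r (exprn_gt0 2 s0)) -exprMn -DE; apply: le_trans hD; lra.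
- have {}yk : kappa < y by rewrite ltNge.
  have k1 : (1 : R) < kappa by rewrite /kappa; lra.
  have lny : 0 < ln y by rewrite ln_gt0 // (lt_trans k1).
  exists (ln y) => [z|m hm].
    rewrite normrM (ger0_norm (ltW lny)) ler_piMr ?(ltW lny) // normr_sg.
    by case: (_ != 0) => /=; lra.
  have D2 : 0 < D ^+ 2 by rewrite exprn_gt0.
  have c0 : 0 <= 64 * y / (9 * D ^+ 2) by apply/ltW/divr_gt0; exact: mulr_gt0.
  exists y^-1, 0, (64 * y / (9 * D ^+ 2)), (9 / y); split.
  + exact: c0.
  + by apply/ltW/divr_gt0.
  + move=> t; rewrite mul0r addr0.
    have Dt : 0 <= 64 * y / (9 * D ^+ 2) * t ^+ 2.
      by rewrite mulr_ge0 ?sqr_ge0.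
    have yV0 : 0 < y^-1 by rewrite invr_gt0.
    have [h|h] := ltrP (m + t - D / 2) 0.
      by rewrite ltr0_sg // mulrN mulr1 expRN lnK ?posrE // lerDl.
    apply: (@le_trans _ _ y).
      rewrite -[leRHS](@lnK _ y) ?posrE // ler_expR ler_piMr ?(ltW lny) //.
      by apply: le_trans (ler_norm _) _; rewrite normr_sg; case: (_ != 0) => /=; lra.
    (* Chebyshev in pointwise form: reaching the midpoint forces [t >= 3 D / 8], so the quadratic is
       at least [y]. *)
    apply: (@le_trans _ _ (64 * y / (9 * D ^+ 2) * t ^+ 2)); last by rewrite lerDr ltW.
    rewrite mulrAC ler_pdivlMr; last exact: mulr_gt0.
    move: hm; rewrite ler_norml => /andP[h1 h2].
    have : (3 / 8 * D) ^+ 2 <= t ^+ 2 by rewrite ler_pXn2r ?nnegrE //; lra.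
    rewrite exprMn => ht.
    have : y * (9 * D ^+ 2) <= y * (64 * t ^+ 2).
      by rewrite ler_pM2l //; move: ht; rewrite (_ : (3 / 8) ^+ 2 = 9 / 64) ?expr2; lra.
    lra.
  + have -> : 64 * y / (9 * D ^+ 2) * sigma ^+ 2 = 64 / 9 / y.
      by rewrite DE; field; rewrite !gt_eqF.
    have := invr_gt0 y; rewrite y0 => yV0; lra.
  + rewrite -[X in _ / X](@lnK _ y) ?posrE // -expRN.
    rewrite -[9 in X in X <= _](@lnK _ 9) ?posrE //.
    rewrite -!expRD ler_expR.
    (* The exponent left is [(1 - 2 eps) ln y - ln 9]; with [eps < 1/32] and [ln 9 <= ln y / 3] it
       is at least [ln y / 2]. *)
    have l9 : ln (9 : R) * 3 <= ln y.
      rewrite -[3]/(3%:R) mulr_natr -lnXn; last by lra.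
      by rewrite ler_ln ?posrE // ?exprn_gt0 //; move: yk; rewrite /kappa !exprS; lra.
    nra.
Qed.

Lemma rate_pow_le sigma D eps (N : nat) b rho :
  expR (2 * b * eps) * rho <= expR (- rate (D / sigma)) -> 0 <= rho ->
  expR (2 * b * eps * N%:R) * rho ^+ N <= expR (- (rate (D / sigma) * N%:R)).
Proof.
move=> h r0; rewrite -mulNr !expRM_natr -exprMn.
by apply: lerXn2r => //; rewrite nnegrE ?mulr_ge0 ?expR_ge0.
Qed.

End TestFunction.

(** * The tournament estimator *)

Section Duel.
Context {R : realType} {n N : nat}.
Implicit Types (v : n.-tuple R) (x : sample R n N).

Definition duel (sigma : R) v v' x : R :=
  score (test_fun sigma (enorm (vsub v' v))) v
        (vscale (enorm (vsub v' v))^-1 (vsub v' v)) x.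

Lemma duelC sigma v v' x : v != v' -> duel sigma v' v x = - duel sigma v v' x.
Proof.
move=> vv'; rewrite /duel (vdistC v v') /score -sumrN; apply: eq_bigr => i _.
have D0 : 0 < enorm (vsub v' v) by apply: vdist_gt0; rewrite eq_sym.
set D := enorm _ in D0 *; rewrite -test_funN; congr (test_fun _ _ _).
have -> : vsub (tnth x i) v' = vsub (vsub (tnth x i) v) (vsub v' v).
  by apply: eq_from_tnth => j; rewrite !tnthE; ring.
have -> : vsub v v' = vscale (-1) (vsub v' v).
  by apply: eq_from_tnth => j; rewrite !tnthE; ring.
rewrite !vdotZr vdotBl -enorm_dot -/D; field.
by rewrite gt_eqF.
Qed.

Lemma duel_total sigma v v' x : v != v' ->
  0 <= duel sigma v v' x \/ 0 <= duel sigma v' v x.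
Proof.
by move=> /(duelC sigma) ->; rewrite oppr_ge0; case: (lerP 0 (duel sigma v v' x)) => [|/ltW]; [left|right].
Qed.

Lemma measurable_duel_ge0 sigma v v' :
  measurable [set x : sample R n N | 0 <= duel sigma v v' x].
Proof. by apply: measurable_score_ge0; exact: measurable_test_fun. Qed.

Lemma duel_tail {d : measure_display} {Omega : measurableType d}
  (P : probability Omega R) (sigma eps : R) (xi : 'I_N -> Omega -> n.-tuple R)
  (mu v v' : n.-tuple R) (C : sample R n N -> sample R n N) :
  iid_Xi P sigma xi -> adversary eps C -> 0 < sigma -> 0 < eps -> eps < 1 / 32 ->
  v != v' -> enorm (vsub mu v) <= enorm (vsub v' v) / 8 ->
  16 * tau * sigma ^+ 2 * eps <= enorm (vsub v' v) ^+ 2 ->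
  (\int[P]_w (\1_[set x | (0 <= duel sigma v v' x)%R] (C (observed xi mu w)))%:E <=
   (expR (- (rate (enorm (vsub v' v) / sigma) * N%:R)))%:E)%E.
Proof.
move=> iid advC s0 e0 e32 vv' muv hD.
have D0 : 0 < enorm (vsub v' v) by apply: vdist_gt0; rewrite eq_sym.
set D := enorm (vsub v' v) in D0 muv hD *; set u := vscale D^-1 (vsub v' v).
have u1 : enorm u = 1 by rewrite enormZ gtr0_norm ?invr_gt0 // mulVf // gt_eqF.
have [b gb H] := test_fun_spec s0 D0 e0 e32 hD.
have [|a1 [a2 [a3 [rho [a30 rho0 maj le_rho hrho]]]]] := H (vdot (vsub mu v) u).
  by apply: le_trans muv; apply: le_trans (vdot_le _ _) _; rewrite u1 mulr1.
apply: (le_trans (score_tail iid advC (measurable_test_fun sigma D) gb u1 a30 maj le_rho)).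
by rewrite lee_fin; exact: rate_pow_le.
Qed.

End Duel.

(** * Measurability of a least index *)

Section FirstHit.
Context {d : measure_display} {X : measurableType d}.
Implicit Types (F : nat -> set X) (x : X).

(** The default [0] adds to the fibre over [0] the points that no [F k] contains. *)
Definition first_hit F x : nat :=
  if pselect (exists k, `[< F k x >]) is left h then ex_minn h else 0%N.

Lemma first_hitP F x k : F k x -> F (first_hit F x) x /\ (first_hit F x <= k)%N.
Proof.
move=> Fk; rewrite /first_hit; case: pselect => [h|]; last first.
  by case; exists k; apply/asboolP.
by case: ex_minnP => m /asboolP Fm mk; split => //; apply: mk; apply/asboolP.
Qed.

Lemma measurable_first_hit F k : (forall i, measurable (F i)) ->
  measurable [set x | first_hit F x = k].
Proof.
move=> mF.
have -> : [set x | first_hit F x = k] =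
    (F k `&` \bigcap_(i in [set i | (i < k)%N]) ~` F i) `|`
    (if k == 0%N then \bigcap_(i in [set: nat]) ~` F i else set0).
  apply/seteqP; split=> x /=.
    have [[i Fi]|nF] := pselect (exists i, F i x).
      have [Fh _] := first_hitP Fi => <-; left; split => // j jh Fj.
      by have [_] := first_hitP Fj; rewrite leqNgt jh.
    rewrite /first_hit; case: pselect => [[i Fi]|_ <-].
      by case: nF; exists i; apply/asboolP.
    by right; rewrite eqxx => i _ Fi; apply: nF; exists i.
  case=> [[Fk nF]|].
    have [Fh hk] := first_hitP Fk.
    apply/eqP; move: hk; rewrite leq_eqVlt => /orP[//|hlt].
    by case: (nF _ hlt Fh).
  case: eqP => [-> nF|_ []]; rewrite /first_hit.
  case: pselect => // -[i Fi]; case: (nF i I); exact/asboolP.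
apply: measurableU.
  by apply: measurableI => //; apply: bigcap_measurableType => i _; exact: measurableC.
by case: ifP => // _; apply: bigcap_measurableType => i _; exact: measurableC.
Qed.

Lemma measurable_fun_nat_range {d' : measure_display} {Y : measurableType d'}
  (f : X -> nat) (e : nat -> Y) :
  (forall k, measurable [set x | f x = k]) -> measurable_fun setT (e \o f).
Proof.
move=> mf _ B mB; rewrite setTI.
have -> : (e \o f) @^-1` B = \bigcup_(k in [set k | B (e k)]) [set x | f x = k].
  by apply/seteqP; split=> [x Bx|x [k Bk fk]]; [exists (f x)|rewrite /= fk].
by apply: bigcup_measurable.
Qed.

End FirstHit.

Section Tournament.
Context {R : realType} {n N : nat}.
Variables (sigma r0 : R) (e : nat -> n.-tuple R).
Hypothesis r0_gt0 : 0 < r0.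

(** Discretised so that a least radius exists and countable unions suffice for measurability; the
    rounding costs the factor 2 in [tournament_error]. *)
Definition radius (j : nat) : R := r0 * j.+1%:R.

(** [0 <= duel sigma v v'] reads as a victory of [v'] over [v]. Opponents within the radius are
    ignored, since losing to them is harmless. *)
Definition unbeaten (j k : nat) : set (sample R n N) :=
  [set x | forall i, radius j < enorm (vsub (e i) (e k)) ->
    ~ (0 <= duel sigma (e k) (e i) x)].

Definition level (x : sample R n N) : nat :=
  first_hit (fun j => \bigcup_k unbeaten j k) x.

Definition selected (x : sample R n N) : nat :=
  first_hit (fun k => [set x | unbeaten (level x) k x]) x.

Definition tournament (x : sample R n N) : n.-tuple R := e (selected x).

Lemma measurable_unbeaten j k : measurable (unbeaten j k).
Proof.
have -> : unbeaten j k = \bigcap_(i in [set i | radius j < enorm (vsub (e i) (e k))])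
    ~` [set x | 0 <= duel sigma (e k) (e i) x].
  by apply/seteqP; split => x h i /=; exact: h.
by apply: bigcap_measurableType => i _; apply: measurableC; exact: measurable_duel_ge0.
Qed.

Lemma measurable_tournament : measurable_fun setT tournament.
Proof.
apply: measurable_fun_nat_range => k.
have mlevel j : measurable [set x | level x = j].
  apply: measurable_first_hit => i; apply: bigcup_measurable => l _.
  exact: measurable_unbeaten.
apply: measurable_first_hit => i.
rewrite (_ : [set x | _] = \bigcup_j ([set x | level x = j] `&` unbeaten j i)).
  apply: bigcup_measurable => j _; apply: measurableI => //.
  exact: measurable_unbeaten.
by apply/seteqP; split=> [x ux|x [j _ [/= lj uj]]]; [exists (level x)|rewrite /= lj].
Qed.

Lemma unbeaten_le j j' k x : (j <= j')%N -> unbeaten j k x -> unbeaten j' k x.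
Proof.
move=> jj' h i hi; apply: h; apply: le_lt_trans hi.
by rewrite /radius ler_pM2l // ler_nat.
Qed.

(** The selected point is unbeaten at a level at most [j]. Were it further than [radius j] from
    [e k], neither could be beaten in their duel, whereas one of them always is. *)
Lemma selected_close j k x : unbeaten j k x ->
  enorm (vsub (tournament x) (e k)) <= radius j.
Proof.
move=> ujk; rewrite leNgt; apply/negP => far.
have [[l _ ul] lj] : (\bigcup_k unbeaten (level x) k) x /\ (level x <= j)%N.
  by apply: (@first_hitP _ _ (fun j => \bigcup_k unbeaten j k)); exists k.
have [us _] : unbeaten (level x) (selected x) x /\ (selected x <= l)%N.
  exact: (@first_hitP _ _ (fun k => [set x | unbeaten (level x) k x])).
have {}us := unbeaten_le lj us.
have ne : e k != tournament x.
  apply: contraTneq far => <-; rewrite vdistxx -leNgt ltW // /radius.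
  by rewrite mulr_gt0.
case: (duel_total sigma x ne); first exact: ujk far.
by apply: us; rewrite vdistC.
Qed.

(** Any large error is charged to one point that beats [e k] from a comparable distance, an event
    suited to a union bound over shells. *)
Lemma tournament_error k x : r0 < enorm (vsub (tournament x) (e k)) ->
  exists i, [/\ r0 < enorm (vsub (e i) (e k)),
    enorm (vsub (tournament x) (e k)) <= 2 * enorm (vsub (e i) (e k)) &
    0 <= duel sigma (e k) (e i) x].
Proof.
set t := enorm _ => t_gt.
have exj : exists j, t <= radius j.
  exists (Num.bound (t / r0)); rewrite /radius mulrC -ler_pdivrMr //.
  apply: ltW; apply: lt_le_trans (archi_boundP _) _; last by rewrite ler_nat.
  by rewrite divr_ge0 ?enorm_ge0 // ltW.
(* The case [0] is excluded by [t > r0 = radius 0]; minimality then puts [t] between consecutive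
   radii. *)
have [[|j] tj minj] := ex_minnP exj.
  by move: tj; rewrite /radius mulr1 leNgt t_gt.
have jt : radius j < t by rewrite ltNge; apply/negP => /minj; rewrite ltnn.
have : ~ unbeaten j k x by move=> /selected_close; rewrite leNgt jt.
move=> /existsNP[i /not_implyP[ri /contrapT di]]; exists i.
have r0j : r0 <= radius j by rewrite /radius ler_peMr ?(ltW r0_gt0) // ler1n.
split => //; first exact: le_lt_trans ri.
apply: (le_trans tj); rewrite (_ : radius j.+1 = radius j + r0).
  by move: ri; set z := enorm _; lra.
by rewrite /radius -[in LHS]natr1 mulrDr mulr1.
Qed.

End Tournament.

Lemma succ_le_exprn {R : realType} (c : R) l : 2 <= c -> (l.+1)%:R <= c ^+ l.
Proof.
move=> c2; elim: l => [|l IH]; first by rewrite expr0.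
have cl : 1 <= c ^+ l by apply: exprn_ege1; lra.
rewrite exprS -natr1; apply: (@le_trans _ _ (2 * c ^+ l)); first lra.
by apply: ler_wpM2r => //; lra.
Qed.

Lemma exists_exprn_scale {R : realType} (c y x : R) : 2 <= c -> 0 < x ->
  exists m : nat, y <= c ^+ m * x.
Proof.
move=> c2 x0; exists (Num.bound (`|y| / x)); set b := `|y| / x.
rewrite -ler_pdivrMr //; apply: (@le_trans _ _ b).
  by rewrite ler_pM2r ?invr_gt0 // ler_norm.
apply: le_trans (succ_le_exprn _ c2); rewrite -natr1 (@le_trans _ _ (Num.bound b)%:R) ?lerDl //.
by apply/ltW/archi_boundP; rewrite divr_ge0 // ltW.
Qed.

Lemma measurable_sqr_vdist {R : realType} {n : nat} {d : measure_display}
  {Omega : measurableType d} (f : Omega -> n.-tuple R) mu : measurable_fun setT f ->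
  measurable_fun setT (fun w => enorm (vsub (f w) mu) ^+ 2).
Proof.
move=> mf; under eq_fun do rewrite sqr_enorm.
apply: measurable_sum => i; apply: measurable_funX.
under eq_fun do rewrite tnthE.
by apply: measurable_funB => //; exact: (measurable_fun_tnthP _).1.
Qed.

(** With [eps * sigma^2 <= eta^2], competitors further apart than [c ^ a * eta] meet the separation
    required by [duel_tail]. It also gives [c ^ a >= 8], so that [mu], within [eta] of [nu], is
    close enough for the test. *)
Definition wide_scale {R : realType} (c : R) (a : nat) := 16 * tau <= (c ^+ a) ^+ 2.

(** * Risk of the tournament, shell by shell *)

Section RiskBound.
Context {R : realType} {n N : nat}.
Variables (K : set (n.-tuple R)) (sigma eps c eta Q : R) (a : nat).
Hypotheses (sigma0 : 0 < sigma) (eps0 : 0 < eps) (eps32 : eps < 1 / 32).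
Hypotheses (c2 : 2 <= c) (eta0 : 0 < eta) (Q1 : 1 <= Q).
Hypothesis eta_eps : eps * sigma ^+ 2 <= eta ^+ 2.
Hypothesis a_large : wide_scale c a.
Hypothesis Mloc_le : forall s, eta <= s -> (Mloc K s c <= Q%:E)%E.
Hypothesis rate_ge : forall l D, (a <= l)%N -> c ^+ l * eta <= D ->
  (l.+2)%:R * ln Q + 3 * (l.+1)%:R * ln c <= rate (D / sigma) * N%:R.

Let c0 : 0 < c. Proof. by apply: lt_le_trans c2. Qed.
Let c1 : 1 <= c. Proof. by apply: le_trans c2; rewrite ler1n. Qed.
Let Q0 : 0 < Q. Proof. exact: lt_le_trans Q1. Qed.
Let r0 := c ^+ a * eta.
Let r00 : 0 < r0. Proof. by rewrite mulr_gt0 // exprn_gt0. Qed.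

Lemma packing_ball_size (G : set (n.-tuple R)) :
  G `<=` K -> (forall x y, G x -> G y -> x != y -> eta < enorm (vsub x y)) ->
  forall v k S, K v -> uniq S -> (forall x, x \in S -> G x /\ enorm (vsub x v) <= c ^+ k * eta) ->
  (size S)%:R <= Q ^+ k.+1.
Proof.
move=> GK pG v k S Kv uS SG.
apply: (packing_iter eta0 c2 Mloc_le Kv); split => //; split=> [x /SG[Gx xv]|x y /SG[Gx _] /SG[Gy _]].
  split; last exact: GK.
  rewrite /cball /=; apply: (le_trans xv).
  by rewrite le_eqVlt exprS; apply/orP; left; apply/eqP; field; rewrite gt_eqF.
exact: pG.
Qed.

Section Fixed.
Variables (G : set (n.-tuple R)) (e : nat -> n.-tuple R).
Hypotheses (GK : G `<=` K) (rangeE : range e = G).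
Hypothesis pG : forall x y, G x -> G y -> x != y -> eta < enorm (vsub x y).
Variables (mu : n.-tuple R) (k0 : nat).
Let nu := e k0.
Hypothesis mu_near : enorm (vsub mu nu) <= eta.

Let Ge i : G (e i). Proof. by rewrite -rangeE; exists i. Qed.

Definition shell (m : nat) : set (n.-tuple R) :=
  [set v | G v /\ c ^+ (a + m) * eta < enorm (vsub v nu) <= c ^+ (a + m).+1 * eta].

Lemma shell_seq m : exists2 s : seq (n.-tuple R), uniq s & forall v, v \in s <-> shell m v.
Proof.
have : finite_set (shell m).
  apply: (@finite_packing_set _ _ eta (shell m) _ (Q ^+ (a + m).+2)) => //.
    by move=> x y [Gx _] [Gy _]; exact: pG.
  move=> S [uS [SB _]]; apply: (packing_ball_size GK pG (GK (Ge k0)) uS).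
  by move=> x /SB[Gx /andP[_ h]].
move=> /finite_seqP[s sE]; exists (undup s); first exact: undup_uniq.
by move=> v; rewrite mem_undup sE.
Qed.

Context {d : measure_display} {Omega : measurableType d}.
Variables (P : probability Omega R) (xi : 'I_N -> Omega -> n.-tuple R).
Hypothesis iid : iid_Xi P sigma xi.
Variable C : sample R n N -> sample R n N.
Hypothesis advC : adversary eps C.

Let X w := C (observed xi mu w).

Let mX : measurable_fun setT X.
Proof. by apply: (measurableT_comp advC.1); exact: (measurable_observed iid). Qed.

Definition shell_loss (m : nat) (s : seq (n.-tuple R)) (w : Omega) : R :=
  (c ^+ (a + m).+1 * eta) ^+ 2 *
  \sum_(v <- s) \1_[set x | 0 <= duel sigma nu v x] (X w).

Lemma shell_loss_ge0 m s w : 0 <= shell_loss m s w.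
Proof. by rewrite mulr_ge0 ?sqr_ge0 // sumr_ge0. Qed.

Let m_indic v : measurable_fun setT
  (fun w => \1_[set x : sample R n N | 0 <= duel sigma nu v x] (X w) : R).
Proof.
apply: (measurableT_comp _ mX); apply: measurable_indic; exact: measurable_duel_ge0.
Qed.

Lemma measurable_shell_loss m s : measurable_fun setT (shell_loss m s).
Proof. by apply: measurable_funM => //; apply: measurable_sum. Qed.

(** [rate_ge] makes each false victory have probability at most [1 / (Q^(l+2) c^(3(l+1)))]. The
    power of [Q] cancels the cardinality of the shell, two of the three powers of [c^(l+1)] cancel
    its squared radius, and the third gives a geometric series. *)
Lemma integral_shell_loss m s : uniq s -> (forall v, v \in s -> shell m v) ->
  (\int[P]_w (shell_loss m s w)%:E <= (eta ^+ 2 / (2 ^ m.+1)%:R)%:E)%E.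
Proof.
move=> us hs; pose r := c ^+ (a + m).+1 * eta.
pose l := (a + m)%N.
have sz : (size s)%:R <= Q ^+ l.+2.
  by apply: (packing_ball_size GK pG (GK (Ge k0)) us) => x /hs[Gx /andP[_ h]].
have tail v : v \in s ->
  (\int[P]_w (\1_[set x | (0 <= duel sigma nu v x)%R] (X w))%:E <=
    ((Q ^+ l.+2 * (c ^+ l.+1) ^+ 3)^-1)%:E)%E.
  move=> /hs[Gv /andP[hlo hhi]]; set D := enorm (vsub v nu) in hlo hhi.
  have r0D : r0 < D.
    apply: le_lt_trans hlo; rewrite /r0 ler_pM2r // exprD ler_peMr ?exprn_ge0 ?(ltW c0) //.
    exact: exprn_ege1.
  have ca : 8 <= c ^+ a.
    rewrite -(@ler_pXn2r _ 2) ?nnegrE ?exprn_ge0 ?(ltW c0) //.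
    apply: le_trans a_large; rewrite /tau /kappa !expr2 => {hlo hhi}; lra.
  have nuv : nu != v.
    by apply: contraTneq r0D => vE; rewrite /D -vE vdistxx -leNgt ltW.
  apply: le_trans (duel_tail iid advC sigma0 eps0 eps32 nuv _ _) _.
  - apply: (le_trans mu_near); rewrite ler_pdivlMr //; apply: le_trans (ltW r0D).
    by rewrite mulrC ler_pM2r.
  - apply: (@le_trans _ _ (r0 ^+ 2)); last by rewrite lerXn2r ?nnegrE ?enorm_ge0 // ltW.
    rewrite /r0 exprMn -mulrA; apply: ler_pM => //.
    + by rewrite !mulr_ge0 // /kappa ?exprn_ge0 //.
    + by rewrite mulr_ge0 ?sqr_ge0 // ltW.
    + by rewrite mulrC.
  rewrite lee_fin; have := rate_ge (leq_addr m a) (ltW hlo).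
  rewrite -/D -/l => hr.
  have Qp : 0 < Q ^+ l.+2 by exact: exprn_gt0.
  have cp : 0 < c ^+ l.+1 by exact: exprn_gt0.
  have cp3 : 0 < c ^+ l.+1 ^+ 3 by exact: exprn_gt0.
  rewrite -[leRHS]lnK ?posrE ?invr_gt0 ?(mulr_gt0 Qp) // ler_expR.
  rewrite lnV ?posrE ?(mulr_gt0 Qp) // lerN2.
  rewrite lnM ?posrE // !lnXn //.
  apply: le_trans hr.
  by rewrite -[ln Q *+ _]mulr_natl -[_ *+ 3]mulr_natl -[ln c *+ _]mulr_natl mulrA.
rewrite /shell_loss -/r.
under eq_integral do rewrite EFinM -sumEFin.
rewrite ge0_integralZl ?lee_fin ?sqr_ge0 //; last 2 first.
- by apply: emeasurable_sum => v; apply/measurable_EFinP.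
- by move=> w _; apply: sume_ge0 => v _; rewrite lee_fin.
rewrite ge0_integral_sum //; last by move=> v; apply/measurable_EFinP.
apply: (@le_trans _ _ ((r ^+ 2)%:E * (Q ^+ l.+2 * (Q ^+ l.+2 * (c ^+ l.+1) ^+ 3)^-1)%:E)%E).
  apply: lee_wpmul2l; first by rewrite lee_fin sqr_ge0.
  apply: (@le_trans _ _ (\sum_(v <- s) ((Q ^+ l.+2 * (c ^+ l.+1) ^+ 3)^-1)%:E)%E).
    by rewrite big_seq [leRHS]big_seq; apply: lee_sum.
  rewrite sumEFin lee_fin big_const_seq count_predT iter_addr_0 -mulr_natl.
  by apply: ler_wpM2r sz; rewrite invr_ge0 mulr_ge0 ?exprn_ge0 ?(ltW c0) ?(ltW Q0).
have cl0 : 0 < c ^+ l.+1 by rewrite exprn_gt0.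
have Ql0 : 0 < Q ^+ l.+2 by rewrite exprn_gt0.
rewrite -EFinM lee_fin invfM mulrA mulrA mulfK ?gt_eqF //.
rewrite /r -/l.
have -> : (c ^+ l.+1 * eta) ^+ 2 / c ^+ l.+1 ^+ 3 = eta ^+ 2 / c ^+ l.+1.
  by field; rewrite gt_eqF.
have p2 : 0 < (2 ^ m.+1)%:R :> R by rewrite ltr0n expn_gt0.
rewrite ler_pM2l ?exprn_gt0 // lef_pV2 ?posrE //.
rewrite natrX /l -addnS exprD -[leLHS]mul1r.
apply: ler_pM => //; first exact: exprn_ege1.
by apply: lerXn2r; rewrite ?nnegrE // (ltW c0).
Qed.

Lemma tournament_risk :
  (\int[P]_w (enorm (vsub (tournament sigma r0 e (X w)) mu) ^+ 2)%:E <=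
    ((10 + 2 * (c ^+ a) ^+ 2) * eta ^+ 2)%:E)%E.
Proof.
have /choice[s hs] : forall m, exists s : seq (n.-tuple R), uniq s /\ forall v, v \in s <-> shell m v.
  by move=> m; have [s us sE] := shell_seq m; exists s.
have loss0 w m : (0%R <= (shell_loss m (s m) w)%:E)%E by rewrite lee_fin shell_loss_ge0.
pose S w := (\sum_(m <oo) (shell_loss m (s m) w)%:E)%E.
have S0 w : (0 <= S w)%E by apply: nneseries_ge0 => m _ _; exact: loss0.
have mS : measurable_fun setT S.
  apply: ge0_emeasurable_sum => [m w _|m] //.
  by move=> _; apply/measurable_EFinP; exact: measurable_shell_loss.
pose b := 2 * eta ^+ 2 + 2 * r0 ^+ 2.
have b0 : 0 <= b by rewrite addr_ge0 // mulr_ge0 // sqr_ge0.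
have pw w : ((enorm (vsub (tournament sigma r0 e (X w)) mu) ^+ 2)%:E <= b%:E + 8%:E * S w)%E.
  set t := enorm (vsub (tournament sigma r0 e (X w)) nu).
  have tri : enorm (vsub (tournament sigma r0 e (X w)) mu) ^+ 2 <= 2 * t ^+ 2 + 2 * eta ^+ 2.
    have h : enorm (vsub (tournament sigma r0 e (X w)) mu) <= t + eta.
      by apply: le_trans (vdist_triangle nu _ mu) _; rewrite lerD2l vdistC.
    apply: (@le_trans _ _ ((t + eta) ^+ 2)).
      by rewrite lerXn2r // nnegrE ?addr_ge0 ?enorm_ge0 // ltW.
    by have := sqr_ge0 (t - eta); rewrite sqrrB sqrrD !mulr2n; lra.
  have [tr|tr] := lerP t r0.
    apply: (@le_trans _ _ b%:E); last by apply: leeDl; rewrite mule_ge0.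
    rewrite lee_fin; apply: (le_trans tri); rewrite /b addrC lerD2l ler_pM2l //.
    by rewrite lerXn2r ?nnegrE ?enorm_ge0 // ltW.
  have [i [Di ti duel_i]] := tournament_error r00 tr.
  set D := enorm (vsub (e i) (e k0)) in Di ti.
  have exm : exists m, D <= c ^+ (a + m).+1 * eta.
    have [m hm] := exists_exprn_scale D c2 eta0; exists m; apply: (le_trans hm).
    by rewrite ler_pM2r //; apply: ler_weXn2l; rewrite // leqW // leq_addl.
  have [m Dm minm] := ex_minnP exm.
  have sm : e i \in s m.
    apply/(hs m).2; split => //; rewrite Dm andbT.
    case: m Dm minm => [|m] Dm minm; first by rewrite addn0.
    by rewrite ltNge; apply/negP; rewrite addnS => /minm; rewrite ltnn.
  (* The witness [e i] alone contributes the squared outer radius of its shell, which is at least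
     [D^2]. *)
  have tS : ((t ^+ 2)%:E <= 4%:E * S w)%E.
    apply: (@le_trans _ _ (4 * shell_loss m (s m) w)%:E).
      rewrite lee_fin; apply: (@le_trans _ _ ((2 * D) ^+ 2)).
        by rewrite lerXn2r ?nnegrE ?enorm_ge0 ?mulr_ge0 ?enorm_ge0.
      rewrite exprMn (_ : 2 ^+ 2 = 4); last by rewrite expr2; lra.
      rewrite ler_pM2l // /shell_loss -[leLHS]mulr1.
      apply: ler_pM; rewrite ?sqr_ge0 //.
        by apply: lerXn2r; rewrite ?nnegrE ?enorm_ge0 // mulr_ge0 ?(ltW eta0) ?exprn_ge0 ?(ltW c0).
      rewrite (bigD1_seq (e i)) //=; last exact: (hs m).1.
      by rewrite indicE mem_set //= lerDl sumr_ge0.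
    rewrite EFinM; apply: lee_wpmul2l; first by rewrite lee_fin.
    apply: le_trans (nneseries_lim_ge m.+1 _); last by [].
    by rewrite big_nat_recr //= leeDr // sume_ge0.
  apply: (@le_trans _ _ (b%:E + (2 * t ^+ 2)%:E)%E).
    rewrite -EFinD lee_fin; apply: (le_trans tri); rewrite /b.
    have := sqr_ge0 r0; lra.
  apply: leeD => //; rewrite EFinM; apply: (@le_trans _ _ (2%:E * (4%:E * S w))%E).
    by apply: lee_wpmul2l; rewrite ?lee_fin.
  by rewrite muleA -EFinM (_ : 2 * 4 = 8) //; lra.
have m8S : measurable_fun setT (fun w => 8%:E * S w)%E by exact: measurable_funeM.
apply: (@le_trans _ _ (\int[P]_w (b%:E + 8%:E * S w))%E).
  apply: ge0_le_integral => //.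
  - by move=> w _; rewrite lee_fin sqr_ge0.
  - apply/measurable_EFinP; apply: measurable_sqr_vdist.
    by apply: (measurableT_comp _ mX); exact: measurable_tournament.
  - exact: emeasurable_funD.
rewrite ge0_integralD //; last by move=> w _; rewrite mule_ge0.
have Sle : (\int[P]_w S w <= (eta ^+ 2)%:E)%E.
  rewrite integral_nneseries //; last first.
    by move=> m; apply/measurable_EFinP; exact: measurable_shell_loss.
  apply: le_trans (epsilon_trick0 xpredT (sqr_ge0 eta)).
  apply: lee_nneseries => m _; first by move=> _; apply: integral_ge0 => w _.
  by apply: integral_shell_loss; [exact: (hs m).1|move=> v /(hs m).2].
have -> : (10 + 2 * (c ^+ a) ^+ 2) * eta ^+ 2 = b + 8 * eta ^+ 2.
  by rewrite /b /r0; ring.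
have -> : (\int[P]_w b%:E = b%:E)%E.
  rewrite integral_cst //; apply: etrans (mule1 _); congr (_ * _)%E.
  exact: probability_setT.
rewrite [leRHS]EFinD leeD2l //.
rewrite ge0_integralZl ?lee_fin // EFinM.
by apply: lee_wpmul2l; rewrite ?lee_fin.
Qed.
End Fixed.
End RiskBound.

(** * Error exponent against entropy *)

Section RateInequality.
Context {R : realType}.

Lemma ln_ge_half (x : R) : 2 <= x -> 1 / 2 <= ln x.
Proof.
move=> x2; have x0 : 0 < x by lra.
have := expR_ge1Dx (- ln x); rewrite expRN lnK ?posrE //.
have : x^-1 <= 2^-1 by rewrite lef_pV2 ?posrE.
lra.
Qed.

Lemma ln_lt_id (x : R) : 0 < x -> ln x < x.
Proof.
move=> x0; have := expR_ge1Dx (ln x); rewrite lnK ?posrE //; lra.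
Qed.

(* [q] plays the role of log M^loc(eta), [x] of eta / sigma and [y] of the
   normalized distance of two competitors. *)
Lemma rate_dominates (c q x y S K1 : R) (N a l : nat) :
  2 <= c -> 1 <= K1 -> 12 * K1 <= S -> 32 * tau * K1 <= c ^+ a ->
  0 < x -> 0 <= q -> q <= N%:R * x ^+ 2 -> q * S ^+ 2 <= N%:R ->
  (a <= l)%N -> c ^+ l * x <= y ->
  K1 * (l.+2)%:R * q <= rate y * N%:R.
Proof.
move=> c2 K11 hS ha x0 q0 qx qS al ly.
have cl0 : 0 < c ^+ l by rewrite exprn_gt0 //; lra.
have lc := succ_le_exprn l c2.
have l1 : (1 : R) <= l.+1%:R by rewrite ler1n.
have l2E : (l.+2)%:R = l.+1%:R + 1 :> R by rewrite natr1.
have cal : c ^+ a <= c ^+ l by rewrite ler_weXn2l //; lra.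
set t := c ^+ l in cl0 lc cal ly; set s := (l.+1)%:R : R in lc l1 l2E.
have N0 : 0 <= N%:R :> R by [].
have tx0 : 0 < t * x by rewrite mulr_gt0.
rewrite l2E /rate; case: ifPn => yk.
  have ta0 : 0 < tau :> R by rewrite /tau /kappa; lra.
  (* One factor [t] pays for the constants, the other for [s = l + 1]. *)
  have h1 : K1 * (s + 1) <= t ^+ 2 / (16 * tau).
    rewrite ler_pdivlMr ?mulr_gt0 //.
    apply: (@le_trans _ _ ((32 * tau * K1) * t)).
      apply: (@le_trans _ _ ((32 * tau * K1) * s)).
        rewrite -subr_ge0 (_ : _ - _ = 16 * tau * K1 * (s - 1)); last by ring.
        by rewrite !mulr_ge0 //; lra.
      by apply: ler_wpM2l => //; rewrite !mulr_ge0 //; lra.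
    by rewrite expr2; apply: ler_wpM2r; [exact: ltW|exact: le_trans ha cal].
  have h2 : K1 * (s + 1) * q <= t ^+ 2 / (16 * tau) * q by exact: ler_wpM2r.
  apply: (le_trans h2).
  apply: (@le_trans _ _ (t ^+ 2 / (16 * tau) * (N%:R * x ^+ 2))).
    by apply: ler_wpM2l => //; rewrite divr_ge0 ?sqr_ge0 // mulr_ge0 // ltW.
  rewrite (_ : _ * _ = (t * x) ^+ 2 / (16 * tau) * N%:R); last by field; rewrite gt_eqF.
  apply: ler_wpM2r => //; apply: ler_wpM2r.
    by rewrite invr_ge0 mulr_ge0 // ltW.
  by rewrite lerXn2r // nnegrE; [exact: ltW|exact: le_trans (ltW tx0) ly].
have {}yk : kappa < y by rewrite ltNge.
have y0 : 0 < y by move: yk; rewrite /kappa; lra.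
have lny : 1 <= ln y.
  have -> : 1 = 1 / 2 + 1 / 2 :> R by lra.
  have -> : y = 2 * (y / 2) by lra.
  rewrite lnM ?posrE ?divr_gt0 //; move: yk; rewrite /kappa => yk.
  by apply: lerD; apply: ln_ge_half; lra.
have S0 : 0 < S by lra.
(* Geometric mean of the bounds [q <= N x^2] and [q S^2 <= N]. *)
have qxS : q * S <= N%:R * x.
  have : (q * S) ^+ 2 <= (N%:R * x) ^+ 2.
    rewrite (_ : (q * S) ^+ 2 = q * (q * S ^+ 2)); last by ring.
    rewrite (_ : (N%:R * x) ^+ 2 = N%:R * x ^+ 2 * N%:R); last by ring.
    by apply: ler_pM => //; rewrite mulr_ge0 ?sqr_ge0.
  by rewrite ler_pXn2r ?nnegrE ?mulr_ge0 ?(ltW x0) ?(ltW S0).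
(* [ln y] measures distance from the scale [sigma], whereas shells are counted from [eta]. The
   difference [ln (1 / x)] is bounded crudely by [1 / x], a cost that [qxS] can pay. *)
have sle : s - 1 <= 2 * ln y + 2 / x.
  have lnt : (s - 1) / 2 <= ln t.
    rewrite /t lnXn; last by lra.
    rewrite -mulr_natl /s -natr1 addrK.
    by have := ler_wpM2l (ler0n R l) (ln_ge_half c2); lra.
  have : ln t + ln x <= ln y by rewrite -lnM ?posrE // ler_ln ?posrE.
  have := ln_lt_id (_ : 0 < x^-1); rewrite invr_gt0 => /(_ x0).
  rewrite lnV ?posrE //; lra.
have qS1 : q * S <= N%:R.
  apply: le_trans qS; rewrite ler_wpM2l // expr2 ler_peMr ?(ltW S0) //; lra.
have k : (s + 1) * (q * S) <= 6 * ln y * N%:R.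
  apply: (@le_trans _ _ ((2 * ln y + 2 + 2 / x) * (q * S))).
    by apply: ler_wpM2r; [rewrite mulr_ge0 // ltW|lra].
  have : 2 / x * (q * S) <= 2 * N%:R.
    by rewrite -mulrA ler_pM2l // mulrC ler_pdivrMr.
  have : (2 * ln y + 2) * (q * S) <= (2 * ln y + 2) * N%:R by apply: ler_wpM2l => //; lra.
  have : 1 * N%:R <= ln y * N%:R by exact: ler_wpM2r.
  rewrite mulrDl; lra.
have : 12 * K1 * ((s + 1) * q) <= S * ((s + 1) * q).
  by apply: ler_wpM2r => //; rewrite mulr_ge0 //; lra.
lra.
Qed.

End RateInequality.

(** * Finiteness of the entropy and of the critical radius *)

Section Entropy.
Context {R : realType} {n N : nat}.
Variables (K : set (n.-tuple R)) (sigma c CN : R).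
Hypotheses (st : star_shapedE K) (ub : ~ bounded_eucl K).
Hypotheses (sigma0 : 0 < sigma) (c32 : 32 <= c) (CN1 : 1 <= CN) (N0 : (0 < N)%N).
Hypothesis sample_size :
  (CN%:E * ereal_sup [set elog (Mloc K delta c) | delta in [set delta : R | (0 < delta)%R]]
    <= (N%:R)%:E)%E.

Lemma Mloc_finite delta : 0 < delta ->
  exists r, [/\ Mloc K delta c = r%:E, 16 <= r & ln r * CN <= N%:R].
Proof.
move=> d0; have CN0 : 0 < CN := lt_le_trans ltr01 CN1.
have M16 := Mloc_ge16 st ub c32 d0.
have : (CN%:E * elog (Mloc K delta c) <= N%:R%:E)%E.
  apply: le_trans sample_size; apply: lee_wpmul2l; first by rewrite lee_fin ltW.
  by apply: ereal_sup_ubound; exists delta.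
case: (Mloc K delta c) M16 => [r| |] //=; last first.
  by rewrite gt0_muley ?lte_fin // leye_eq.
rewrite !lee_fin => r16 h; exists r; split => //.
by rewrite mulrC.
Qed.

(** Admissibility bounds [N delta^2 / sigma^2] by the entropy, and the sample size bounds [CN] times
    the entropy by [N]; dividing by [N] leaves a bound independent of it. *)
Lemma delta_in_le delta : 0 <= delta ->
  ((N%:R * delta ^+ 2 / sigma ^+ 2)%:E <= elog (Mloc K delta c))%E ->
  CN * delta ^+ 2 <= sigma ^+ 2.
Proof.
rewrite le_eqVlt => /orP[/eqP <- _|d0]; first by rewrite expr0n mulr0 sqr_ge0.
have [r [-> r16 rN]] := Mloc_finite d0; rewrite /= lee_fin => h.
have NR : 0 < N%:R :> R by rewrite ltr0n.
have s2 : 0 < sigma ^+ 2 by rewrite exprn_gt0.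
move: h; rewrite ler_pdivrMr // => h.
have CN0 : 0 < CN := lt_le_trans ltr01 CN1.
rewrite -(ler_pM2l NR) mulrCA; apply: (@le_trans _ _ (CN * (ln r * sigma ^+ 2))).
  by rewrite ler_pM2l.
by rewrite mulrA (mulrC CN) ler_pM2r.
Qed.

Lemma delta_star_fin : exists2 ds : R, delta_star K N sigma c = ds%:E & 0 <= ds.
Proof.
have [a Ka _] := st.
have lo : (0 <= delta_star K N sigma c)%E.
  apply: ereal_sup_ubound; exists 0 => //; split => //.
  rewrite expr0n /= mulr0 mul0r.
  have M1 : (1%:E <= Mloc K 0 c)%E.
    rewrite (_ : 1 = (size [:: a])%:R) //; apply: (@packing_le_Mloc _ _ _ _ _ a) => //.
    split=> //; split=> [x|x y]; rewrite !inE => /eqP ->.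
      by split => //; rewrite /cball /= vdistxx.
    by move=> /eqP ->; rewrite eqxx.
  case: (Mloc K 0 c) M1 => [r| |] /=; rewrite ?leey // !lee_fin; exact: ln_ge0.
have hi : (delta_star K N sigma c <= sigma%:E)%E.
  apply: ge_ereal_sup => _ [d [d0 hd] <-]; rewrite lee_fin.
  have := delta_in_le d0 hd => h.
  rewrite -(@ler_pXn2r _ 2) ?nnegrE ?(ltW sigma0) //; apply: le_trans h.
  by rewrite ler_peMl ?sqr_ge0.
move: lo hi; case: (delta_star K N sigma c) => [ds| |] //.
by rewrite lee_fin => ds0 _; exists ds.
Qed.

Lemma Mloc_above_delta_star ds eta r : delta_star K N sigma c = ds%:E ->
  0 <= eta -> ds < eta -> Mloc K eta c = r%:E ->
  ln r <= N%:R * (eta / sigma) ^+ 2.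
Proof.
move=> dsE eta0 hds ME; apply: contraTle hds => h; rewrite -leNgt -lee_fin -dsE.
apply: ereal_sup_ubound; exists eta => //; split => //.
by rewrite ME /= lee_fin -mulrA -expr_div_n ltW.
Qed.

End Entropy.

(** * Upper bound: choice of the constants *)

Section Upper.
Context {R : realType}.

Lemma exists_scale (c y : R) : 2 <= c -> exists a : nat, y <= c ^+ a.
Proof.
move=> c2; have [a] := exists_exprn_scale y c2 (ltr01 : 0 < (1 : R)).
by rewrite mulr1; exists a.
Qed.

Lemma minimax_upper (c : R) : 32 <= c -> exists CN B : R, [/\ 1 <= CN, 0 < B &
  forall (n N : nat) (K : set (n.-tuple R)) (sigma eps : R),
    (0 < N)%N -> star_shapedE K -> ~ bounded_eucl K ->
    0 < sigma -> 0 < eps -> eps < 1 / 32 ->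
    ((CN%:E * ereal_sup [set elog (Mloc K delta c) | delta in [set delta : R | (0 < delta)%R]])
        <= (N%:R)%:E)%E ->
    (minimax_risk N K sigma eps <=
      B%:E * Order.max (delta_star K N sigma c * delta_star K N sigma c)
                       (eps * sigma ^+ 2)%:E)%E].
Proof.
move=> c32; have c2 : 2 <= c by lra.
have lnc : 0 <= ln c by apply: ln_ge0; lra.
(* Since [ln Q >= 1/2], the terms in [ln c] become multiples of [ln Q]: [3 ln c <= 6 ln c ln Q]. *)
pose K1 : R := 1 + 6 * ln c.
have K11 : 1 <= K1 by rewrite /K1; lra.
have tau1 : 1 <= tau :> R by rewrite /tau /kappa; lra.
have [a ha] := exists_scale (32 * tau * K1) c2.
have ca1 : 1 <= c ^+ a by apply: exprn_ege1; lra.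
have wide : wide_scale c a.
  rewrite /wide_scale; apply: (@le_trans _ _ (c ^+ a)).
    apply: le_trans ha; rewrite -subr_ge0.
    rewrite (_ : _ - _ = 32 * tau * (K1 - 1) + 16 * tau); last by ring.
    by rewrite addr_ge0 // !mulr_ge0 //; lra.
  by rewrite expr2 ler_peMl //; lra.
exists ((12 * K1) ^+ 2), ((10 + 2 * (c ^+ a) ^+ 2) * 4); split.
- by rewrite exprn_ege1 //; lra.
- by rewrite mulr_gt0 // ltr_pwDl // mulr_ge0 // sqr_ge0.
move=> n N K sigma eps N0 st ub s0 e0 e32 hN.
have CN1 : 1 <= (12 * K1) ^+ 2 by rewrite exprn_ege1 //; lra.
have [ds dsE ds0] := delta_star_fin st ub s0 c32 CN1 N0 hN.
have es0 : 0 < eps * sigma ^+ 2 by rewrite mulr_gt0 // exprn_gt0.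
(* The factor 2 puts [eta] strictly above [delta_star], hence outside the admissible set; if
   [ds = 0], the second term does so. *)
pose eta := Num.max (2 * ds) (Num.sqrt (eps * sigma ^+ 2)).
have eta_s : Num.sqrt (eps * sigma ^+ 2) <= eta by rewrite /eta le_max lexx orbT.
have eta0 : 0 < eta by apply: lt_le_trans eta_s; rewrite sqrtr_gt0.
have ds_eta : ds < eta.
  move: ds0; rewrite le_eqVlt => /orP[/eqP <- //|dsp].
  by rewrite /eta lt_max; apply/orP; left; lra.
have eta_eps : eps * sigma ^+ 2 <= eta ^+ 2.
  rewrite -[leLHS](@sqr_sqrtr R) ?(ltW es0) //.
  by rewrite lerXn2r // ?nnegrE ?sqrtr_ge0 // ltW.
have eta_m : eta ^+ 2 <= 4 * Num.max (ds * ds) (eps * sigma ^+ 2).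
  rewrite /eta; case: (lerP (2 * ds)) => _.
    by rewrite sqr_sqrtr ?(ltW es0) //; have : eps * sigma ^+ 2 <= Num.max (ds * ds) (eps * sigma ^+ 2);
      [rewrite le_max lexx orbT|lra].
  have : ds * ds <= Num.max (ds * ds) (eps * sigma ^+ 2) by rewrite le_max lexx.
  by rewrite exprMn !expr2; lra.
have [Q [QE Q16 QN]] := Mloc_finite st ub c32 CN1 hN eta0.
have Qeta := Mloc_above_delta_star dsE (ltW eta0) ds_eta QE.
have c0 : 0 < c by lra.
have Mle s : eta <= s -> (Mloc K s c <= Q%:E)%E.
  by move=> hs; rewrite -QE; exact: Mloc_nonincreasing.
have Q1 : 1 <= Q by lra.
have lnQ : 1 / 2 <= ln Q by apply: ln_ge_half; lra.
have rate_ge l D : (a <= l)%N -> c ^+ l * eta <= D ->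
    l.+2%:R * ln Q + 3 * l.+1%:R * ln c <= rate (D / sigma) * N%:R.
  move=> al lD; apply: (@le_trans _ _ (K1 * l.+2%:R * ln Q)).
    have h1 : ln c * l.+1%:R <= ln c * l.+2%:R by rewrite ler_wpM2l // ler_nat.
    have h2 : ln c * l.+2%:R * (1 / 2) <= ln c * l.+2%:R * ln Q.
      by rewrite ler_wpM2l // mulr_ge0.
    by rewrite /K1; clear lD al; lra.
  apply: (rate_dominates c2 K11 (lexx _) ha _ _ Qeta QN al).
  - by rewrite divr_gt0.
  - by lra.
  - by rewrite mulrA ler_pM2r ?invr_gt0.
have [G [GK pG covG]] := exists_max_packing_set K eta.
have [k Kk _] := st; have [g0 Gg0 _] := covG k Kk.
have [e eG] : exists e : nat -> n.-tuple R, range e = G.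
  apply: (exists_enum_of_bounded_finite Gg0) => r.
  have [m hm] := exists_exprn_scale r c2 eta0.
  apply: (@finite_packing_set _ _ eta (G `&` cball g0 r) _ (Q ^+ m.+1)) => //.
    by move=> x y [Gx _] [Gy _]; exact: pG.
  move=> S [uS [SB _]].
  apply: (packing_ball_size c2 eta0 Mle GK pG (GK _ Gg0) uS) => x /SB[Gx xr].
  by split => //; exact: le_trans xr hm.
rewrite dsE; pose M := Num.max (ds * ds) (eps * sigma ^+ 2).
have -> : (Order.max (ds%:E * ds%:E) (eps * sigma ^+ 2)%:E = M%:E)%E.
  by rewrite -EFinM /M EFin_max.
pose muhat := @tournament R n N sigma (c ^+ a * eta) e.
apply: (@le_trans _ _ (ereal_sup [set r | exists mu, K mu /\
          exists (d : measure_display) (Omega : measurableType d)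
                 (P : probability Omega R) (xi : 'I_N -> Omega -> n.-tuple R),
            iid_Xi P sigma xi /\
            exists C, adversary eps C /\ r = risk P xi mu muhat C])).
  apply: ereal_inf_lbound; exists muhat; split => //.
  exact: measurable_tournament.
apply: ge_ereal_sup => _ [mu [Kmu [d [W [P [xi [iid [C [advC ->]]]]]]]]].
have [g Gg near] := covG mu Kmu.
have [k0 _ gE] : range e g by rewrite eG.
have mu_near : enorm (vsub mu (e k0)) <= eta.
  by rewrite gE; case: near => [->|//]; rewrite vdistxx ltW.
apply: le_trans (tournament_risk s0 e0 e32 c2 eta0 Q1 eta_eps wide Mle rate_ge GK eG pG mu_near iid advC) _.
rewrite -EFinM lee_fin -mulrA ler_wpM2l //.
by rewrite addr_ge0 // mulr_ge0 // sqr_ge0.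
Qed.

End Upper.

(** * Lower bounds *)

Section FiniteProbability.
Context {R : realType} {F : finType}.
Variables (x0 : F) (w : F -> R).
Hypotheses (w_ge0 : forall a, 0 <= w a) (w_sum1 : \sum_a w a = 1).

(* The finite space [F] is carried by [nat], where every set is measurable;
   indices [k >= #|F|] decode to [x0] but have no mass. *)
Definition decode (k : nat) : F := nth x0 (enum F) k.

Definition finite_measure_of : set nat -> \bar R :=
  msum (fun k => mscale (NngNum (w_ge0 (decode k))) (dirac k)) #|F|.

HB.instance Definition _ := Measure.on finite_measure_of.

Lemma sum_decode (V : nmodType) (h : F -> V) : \sum_(k < #|F|) h (decode k) = \sum_a h a.
Proof.
rewrite [RHS]big_enum_val /=; apply: eq_bigr => k _; congr h.
by rewrite /decode (enum_val_nth x0).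
Qed.

Lemma ge0_integral_finite_measure (h : F -> R) : (forall a, 0 <= h a) ->
  (\int[finite_measure_of]_k (h (decode k))%:E = (\sum_a w a * h a)%:E)%E.
Proof.
move=> h0; rewrite ge0_integral_measure_sum //=; last by move=> k _; rewrite lee_fin.
rewrite -(sum_decode (fun a => w a * h a)) -sumEFin; apply: eq_bigr => k _.
rewrite ge0_integral_mscale //=; last by move=> j _; rewrite lee_fin.
by rewrite integral_dirac //= diracT mul1e EFinM.
Qed.

Lemma finite_measure_setT : finite_measure_of setT = 1%E.
Proof.
have := ge0_integral_finite_measure (fun _ => ler01).
rewrite integral_cst // mul1e => ->.
by under eq_bigr do rewrite mulr1; rewrite w_sum1.
Qed.

HB.instance Definition _ := Measure_isProbability.Build _ _ _
  finite_measure_of finite_measure_setT.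

Definition finite_probability : probability nat R := finite_measure_of.

Lemma integrable_finite_probability (h : F -> R) :
  finite_probability.-integrable setT (fun k => (h (decode k))%:E).
Proof.
have : finite_probability.-integrable setT (EFin \o (fun k => h (decode k))).
  apply: measurable_bounded_integrable => //.
    by apply: (le_lt_trans (probability_le1 _ _)) => //; exact: ltry.
  exists (\sum_a `|h a|); split; first by rewrite num_real.
  move=> M hM k _ /=; apply: le_trans (ltW hM).
  by rewrite (bigD1 (decode k)) //= lerDl sumr_ge0.
by [].
Qed.

Lemma Rintegral_finite_probability (h : F -> R) :
  \int[finite_probability]_k h (decode k) = \sum_a w a * h a.
Proof.
(* A constant shift reduces to a nonnegative integrand. *)
pose c := \sum_a `|h a|.
have hc a : 0 <= h a + c.
  rewrite /c (bigD1 a) //= addrA addr_ge0 ?sumr_ge0 //.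
  by rewrite -lerBlDl sub0r -normrN ler_norm.
have : \int[finite_probability]_k (h (decode k) + c) = \sum_a w a * h a + c.
  rewrite /Rintegral (ge0_integral_finite_measure hc) /=.
  under eq_bigr do rewrite mulrDr.
  by rewrite big_split /= -mulr_suml w_sum1 mul1r.
rewrite RintegralD //; last 2 first.
- exact: integrable_finite_probability.
- exact: (integrable_finite_probability (fun _ => c)).
rewrite Rintegral_cst // (_ : fine _ = 1) ?mulr1; first exact: addIr.
exact: (congr1 fine (probability_setT finite_probability)).
Qed.

Lemma finite_probabilityE (B : F -> bool) :
  finite_probability [set k | B (decode k)] = (\sum_a w a * (B a)%:R)%:E.
Proof.
rewrite -ge0_integral_finite_measure; last by move=> a; rewrite ler0n.
rewrite -[LHS]mul1e -[in LHS](setIT [set _ | _]) mul1e -integral_indic //.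
by apply: eq_integral => k _; rewrite indicE; congr ((nat_of_bool _)%:R%:E); apply/idP/idP; rewrite inE.
Qed.

End FiniteProbability.

(** * Product laws on a finite alphabet *)

Section ProductWeights.
Context {R : realType} {E : finType} {N : nat}.
Variables (e0 : E) (p : E -> R).
Hypotheses (p_ge0 : forall a, 0 <= p a) (p_sum1 : \sum_a p a = 1).

Definition product_weight (f : {ffun 'I_N -> E}) : R := \prod_(i < N) p (f i).

Lemma product_weight_ge0 f : 0 <= product_weight f.
Proof. by apply: prodr_ge0. Qed.

Lemma sum_product_weight (H : 'I_N -> E -> R) :
  \sum_f product_weight f * \prod_(i < N) H i (f i) =
  \prod_(i < N) \sum_a p a * H i a.
Proof.
rewrite bigA_distr_bigA; apply: eq_bigr => f _.
by rewrite /product_weight -big_split.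
Qed.

Lemma product_weight_sum1 : \sum_f product_weight f = 1.
Proof.
have := sum_product_weight (fun _ _ => 1).
under eq_bigr do rewrite big1 ?mulr1 //.
by move=> ->; rewrite big1 // => i _; under eq_bigr do rewrite mulr1.
Qed.

Lemma sum_product_weight1 i (H : E -> R) :
  \sum_f product_weight f * H (f i) = \sum_a p a * H a.
Proof.
have := sum_product_weight (fun j => if j == i then H else fun _ => 1).
under eq_bigr => f _.
  rewrite (bigD1 i) //= eqxx big1 ?mulr1 => [|j /negPf -> //].
  over.
move=> ->; rewrite (bigD1 i) //= eqxx [X in _ * X]big1 ?mulr1 // => j /negPf ->.
by under eq_bigr do rewrite mulr1.
Qed.

Definition product_probability : probability nat R :=
  finite_probability [ffun => e0] product_weight_ge0 product_weight_sum1.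

Let dec : nat -> {ffun 'I_N -> E} := decode [ffun => e0].

Context {n : nat}.
Variables (sigma : R) (g : E -> n.-tuple R).
Hypothesis g_mean : forall j, \sum_a p a * tnth (g a) j = 0.
Hypothesis g_var : forall u : n.-tuple R,
  \sum_a p a * vdot (g a) u ^+ 2 <= sigma ^+ 2 * enorm u ^+ 2.

Definition product_noise (i : 'I_N) (k : nat) : n.-tuple R := g (dec k i).

Lemma product_noise_mean i : mean_vec product_probability (product_noise i) = 0.
Proof.
apply/rowP => j; rewrite !mxE.
have := Rintegral_finite_probability [ffun => e0] product_weight_ge0
  product_weight_sum1 (fun f => tnth (g (f i)) j).
rewrite (sum_product_weight1 i (fun a => tnth (g a) j)) g_mean.
exact.
Qed.

Lemma product_noise_iid : iid_Xi product_probability sigma product_noise.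
Proof.
have probE (B : {ffun 'I_N -> E} -> bool) :
    product_probability [set k | B (dec k)] = (\sum_f product_weight f * (B f)%:R)%:E.
  exact: finite_probabilityE.
split; [|split].
- move=> i; split=> //; split=> [j|].
    exact: (integrable_finite_probability [ffun => e0] product_weight_ge0
      product_weight_sum1 (fun f => tnth (g (f i)) j)).
  split=> [j|].
    exact: (integrable_finite_probability [ffun => e0] product_weight_ge0
      product_weight_sum1 (fun f => tnth (g (f i)) j ^+ 2)).
  split=> [|u]; first exact: product_noise_mean.
  pose v := [tuple u 0 j | j < n].
  have covE j k : cov_mx product_probability (product_noise i) j k =
      \sum_a p a * (tnth (g a) j * tnth (g a) k).
    rewrite mxE product_noise_mean !mxE.
    under eq_Rintegral do rewrite !subr0.
    rewrite -(sum_product_weight1 i (fun a => tnth (g a) j * tnth (g a) k)).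
    exact: (Rintegral_finite_probability [ffun => e0] product_weight_ge0
      product_weight_sum1 (fun f => tnth (g (f i)) j * tnth (g (f i)) k)).
  rewrite subr_ge0; have := g_var v; congr (_ <= _); last first.
    rewrite mul_mx_scalar -scalemxAl !mxE; congr (_ * _).
    rewrite sqr_enorm; apply: eq_bigr => j _.
    by rewrite !mxE tnth_mktuple expr2.
  rewrite !mxE.
  transitivity (\sum_(k < n) \sum_(j < n) \sum_a
      p a * (tnth (g a) j * tnth (g a) k) * (u 0 j * u 0 k)).
    rewrite [RHS]exchange_big /=; under [RHS]eq_bigr do rewrite exchange_big /=.
    rewrite [RHS]exchange_big /=; apply: eq_bigr => a _.
    rewrite expr2 {1}/vdot mulr_suml mulr_sumr; apply: eq_bigr => j _.
    rewrite /vdot !mulr_sumr; apply: eq_bigr => k _.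
    by rewrite !tnth_mktuple; ring.
  apply: eq_bigr => k _; rewrite !mxE mulr_suml; apply: eq_bigr => j _.
  by rewrite covE mulr_sumr mulr_suml; apply: eq_bigr => a _; ring.
- move=> i j B _.
  have marg l : product_probability (product_noise l @^-1` B) =
      (\sum_a p a * (g a \in B)%:R)%:E.
    rewrite -(sum_product_weight1 l (fun a => (g a \in B)%:R)).
    rewrite -(probE (fun f => g (f l) \in B)); congr (product_probability _).
    by apply/seteqP; split=> k /=; rewrite inE.
  by rewrite !marg.
- move=> B _.
  have marg l : product_probability (product_noise l @^-1` B l) =
      (\sum_a p a * (g a \in B l)%:R)%:E.
    rewrite -(sum_product_weight1 l (fun a => (g a \in B l)%:R)).
    rewrite -(probE (fun f => g (f l) \in B l)); congr (product_probability _).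
    by apply/seteqP; split=> k /=; rewrite inE.
  under [RHS]eq_bigr do rewrite marg.
  rewrite prodEFin -sum_product_weight.
  transitivity (product_probability [set k | [forall i, g (dec k i) \in B i]]).
    congr (product_probability _); apply/seteqP; split=> k /=.
      by move=> h; apply/forallP => i; rewrite inE; exact: (h i I).
    by move=> /forallP h i _; have := h i; rewrite inE.
  rewrite (probE (fun f => [forall i, g (f i) \in B i])); congr EFin.
  apply: eq_bigr => f _; congr (_ * _); case: forallP => [h|h].
    by rewrite big1 // => i _; rewrite h.
  have [i hi] : exists i, g (f i) \notin B i.
    by apply/existsP; rewrite -negb_forall; apply/negP => /forallP.
  by rewrite (bigD1 i) //= (negPf hi) mul0r.
Qed.

Lemma product_risk (mu : n.-tuple R) (muhat : sample R n N -> n.-tuple R) C :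
  risk product_probability product_noise mu muhat C =
  (\sum_f product_weight f *
     enorm (vsub (muhat (C [tuple vadd mu (g (f i)) | i < N])) mu) ^+ 2)%:E.
Proof.
rewrite -(ge0_integral_finite_measure [ffun => e0] product_weight_ge0) //.
by move=> f; rewrite sqr_ge0.
Qed.

End ProductWeights.

Section LowerBound.
Context {R : realType} {n N : nat}.
Variables (K : set (n.-tuple R)) (sigma eps : R).

(** Both the mean and the noise law may be chosen after seeing the estimator. *)
Lemma minimax_ge (L : \bar R) :
  (forall muhat : sample R n N -> n.-tuple R, measurable_fun setT muhat ->
    exists mu, K mu /\ exists (P : probability nat R) (xi : 'I_N -> nat -> n.-tuple R),
      iid_Xi P sigma xi /\ exists C, adversary eps C /\ (L <= risk P xi mu muhat C)%E) ->
  (L <= minimax_risk N K sigma eps)%E.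
Proof.
move=> H; apply: le_ereal_inf_tmp => _ [muhat [mm ->]].
have [mu [Kmu [P [xi [iid [C [advC LC]]]]]]] := H muhat mm.
apply: le_trans LC _; apply: ereal_sup_ubound; exists mu; split => //.
by exists _, _, P, xi; split => //; exists C.
Qed.

Lemma adversary_id : 0 <= eps -> adversary eps (id : sample R n N -> sample R n N).
Proof.
move=> e0; split=> [|x]; first exact: measurable_id.
rewrite eq_card0 ?mulr_ge0 // => i; rewrite !inE; exact/negbTE/negPn.
Qed.

End LowerBound.

(** * Lower bound from contamination *)

Section Contamination.
Context {R : realType} {n N : nat}.
Implicit Types (a u : n.-tuple R).

(** Leaves the sample untouched when erasing would exceed the budget, because the budget must hold
    for every input. *)
Definition eraser (eps : R) a (x : sample R n N) : sample R n N :=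
  if #|[pred i | tnth x i != a]|%:R <= eps * N%:R then [tuple a | _ < N] else x.

Lemma card_neq_sum a (x : sample R n N) :
  #|[pred i | tnth x i != a]|%:R = \sum_(i < N) (tnth x i != a)%:R :> R.
Proof. by rewrite -sum1_card natr_sum big_mkcond /=; apply: eq_bigr => i _; rewrite inE; case: (tnth x i == a). Qed.

Lemma measurable_singleton_tuple a : measurable [set a].
Proof.
have -> : [set a] = \bigcap_(i in [set: 'I_n]) ((fun x : n.-tuple R => tnth x i) @^-1` [set tnth a i]).
  apply/seteqP; split=> x /=; first by move=> ->.
  by move=> h; apply: eq_from_tnth => i; exact: (h i I).
apply: fin_bigcap_measurable => // i _; rewrite -[X in measurable X]setTI.
exact: (measurable_tnth i).
Qed.

Lemma eraser_adversary eps a : 0 <= eps -> adversary eps (eraser eps a).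
Proof.
move=> e0; split=> [|x]; last first.
  rewrite /eraser; case: ifPn => [h|_].
    apply: le_trans h; rewrite ler_nat; apply: subset_leq_card.
    by apply/fintype.subsetP => i; rewrite !inE tnth_mktuple eq_sym.
  rewrite eq_card0 ?mulr_ge0 // => i; rewrite !inE; exact/negbTE/negPn.
rewrite /eraser; apply: measurable_fun_ifT => //.
under eq_fun do rewrite card_neq_sum.
apply: measurable_fun_ler => //; apply: measurable_sum => i.
have -> : (fun x : sample R n N => (tnth x i != a)%:R : R) =
   (fun x : sample R n N => \1_(~` [set a]) (tnth x i)).
  apply/funext => x; rewrite indicE; case: eqP => [xa|xa].
    by rewrite memNset // => /(_ xa).
  by rewrite mem_set.
have mI : measurable_fun setT (\1_(~` [set a]) : n.-tuple R -> R).
  by apply: measurable_indic; apply: measurableC; exact: measurable_singleton_tuple.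
exact: (measurableT_comp mI (measurable_tnth i)).
Qed.

Lemma minimax_contamination (K : set (n.-tuple R)) (sigma eps : R) :
  (0 < N)%N -> star_shapedE K -> ~ bounded_eucl K ->
  0 < sigma -> 0 < eps -> eps < 1 / 32 ->
  ((eps * sigma ^+ 2 / 16)%:E <= minimax_risk N K sigma eps)%E.
Proof.
move=> N0 st ub sg0 e0 e32; apply: minimax_ge => muhat mm.
(* The rare atom has mass [s^2 = eps / 2], half the budget, so Markov's inequality leaves
   probability at least one half for a complete erasure. *)
pose s := Num.sqrt (eps / 2).
have s0 : 0 < s by rewrite sqrtr_gt0 divr_gt0.
have s2 : s ^+ 2 = eps / 2 by rewrite sqr_sqrtr // divr_ge0 // ltW.
have [a Ka /(_ _ (mulr_gt0 s0 sg0))[u u1 Ku]] := star_unbounded_ray st ub.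
pose mu2 := vadd a (vscale (s * sigma) u).
have Kmu2 : K mu2 by apply: Ku; rewrite lexx andbT mulr_ge0 // ltW.
pose w (b : bool) : R := if b then s ^+ 2 else 1 - s ^+ 2.
have w0 b : 0 <= w b by case: b; rewrite /w ?sqr_ge0 // s2; lra.
have w1 : \sum_b w b = 1 by rewrite big_bool /w /=; ring.
pose theta := muhat [tuple a | _ < N].
have aE : vadd a (vscale 0 u) = a by apply: eq_from_tnth => i; rewrite !tnthE; ring.
have d12 : s * sigma <= enorm (vsub theta a) + enorm (vsub theta mu2).
  rewrite -[s * sigma]ger0_norm ?mulr_ge0 ?(ltW s0) ?(ltW sg0) //.
  rewrite -[s * sigma]subr0 -[leLHS]mulr1 -u1 -(vdist_line a u) aE vdistC.
  by rewrite (vdistC theta a); exact: vdist_triangle.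
(* Both hypotheses can show the constant sample [a]; the resulting estimate [theta] is far from one
   of the two means. *)
have [far1|near1] := lerP (s * sigma / 2) (enorm (vsub theta a)).
  exists a; split => //.
  pose g (b : bool) := vscale 0 u.
  have gm j : \sum_b w b * tnth (g b) j = 0.
    by rewrite big1 // => b _; rewrite tnthE mul0r mulr0.
  have gv v : \sum_b w b * vdot (g b) v ^+ 2 <= sigma ^+ 2 * enorm v ^+ 2.
    rewrite big1 => [|b _]; first by apply: mulr_ge0; exact: sqr_ge0.
    by rewrite vdotZl mul0r expr0n mulr0.
  exists (product_probability (N := N) false w0 w1), (product_noise (N := N) false g); split.
    exact: product_noise_iid.
  exists id; split; first exact/adversary_id/ltW.
  rewrite product_risk lee_fin.
  under eq_bigr => f _.
    have -> : [tuple vadd a (g (f i)) | i < N] = [tuple a | _ < N].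
      by apply: eq_from_tnth => i; rewrite !tnth_mktuple aE.
    over.
  rewrite -mulr_suml product_weight_sum1 // mul1r -/theta.
  apply: (@le_trans _ _ ((s * sigma / 2) ^+ 2)).
    by rewrite !exprMn s2 exprVn (_ : 2 ^+ 2 = 4); [have := mulr_gt0 e0 (exprn_gt0 2 sg0); lra|rewrite expr2; lra].
  by rewrite lerXn2r // nnegrE ?enorm_ge0 // divr_ge0 // mulr_ge0 // ltW.
have far2 : s * sigma / 2 <= enorm (vsub theta mu2) by lra.
exists mu2; split => //.
(* Under [mu2] an observation is [a + (sigma / s) u] with mass [s^2] and [a] otherwise: the mean is
   [mu2] and the variance along [u] is [sigma^2 (1 - s^2)]. *)
pose k (b : bool) : R := if b then sigma / s - s * sigma else - (s * sigma).
pose g b := vscale (k b) u.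
have gm j : \sum_b w b * tnth (g b) j = 0.
  by rewrite big_bool !tnthE /w /k /=; field; rewrite gt_eqF.
have gv v : \sum_b w b * vdot (g b) v ^+ 2 <= sigma ^+ 2 * enorm v ^+ 2.
  apply: (@le_trans _ _ (sigma ^+ 2 * (1 - s ^+ 2) * vdot u v ^+ 2)).
    rewrite big_bool !vdotZl /w /k /= le_eqVlt; apply/orP; left; apply/eqP.
    by field; rewrite gt_eqF.
  have := vdot_sqr_le u v; rewrite u1 expr1n mul1r => uv.
  rewrite -mulrA; apply: ler_wpM2l; first exact: sqr_ge0.
  apply: le_trans uv; rewrite ler_piMl ?sqr_ge0 // gerBl sqr_ge0 //.
exists (product_probability (N := N) false w0 w1), (product_noise (N := N) false g); split.
  exact: product_noise_iid.
exists (eraser eps a); split; first exact/eraser_adversary/ltW.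
rewrite product_risk lee_fin.
pose cc := (s * sigma / 2) ^+ 2.
have eN : 0 < eps * N%:R by rewrite mulr_gt0 // ltr0n.
have draw b : vadd mu2 (g b) = vadd a (vscale (if b then sigma / s else 0) u).
  by apply: eq_from_tnth => i; rewrite !tnthE /k; case: b; ring.
(* One minus the count of rare atoms over [eps * N] minorizes the indicator of complete erasure:
   Markov's inequality in linear form. *)
apply: (@le_trans _ _ (\sum_f product_weight w f *
    (cc * (1 - (\sum_(i < N) (f i)%:R) / (eps * N%:R))))); last first.
  apply: ler_sum => f _; apply: ler_wpM2l; first exact: product_weight_ge0.
  set X := [tuple _ | _ < N].
  have cardX : #|[pred i | tnth X i != a]|%:R <= \sum_(i < N) (f i)%:R :> R.
    rewrite card_neq_sum; apply: ler_sum => i _; rewrite tnth_mktuple draw.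
    by case: (f i); rewrite ?aE ?eqxx // ler_nat leq_b1.
  have [few|many] := lerP (\sum_(i < N) (f i)%:R) (eps * N%:R).
    rewrite /eraser (le_trans cardX few) -/theta.
    apply: (@le_trans _ _ cc).
      rewrite ler_piMr ?sqr_ge0 // gerBl divr_ge0 ?(ltW eN) // sumr_ge0 //.
    by rewrite lerXn2r // nnegrE ?enorm_ge0 // divr_ge0 // mulr_ge0 // ltW.
  apply: (@le_trans _ _ 0); last exact: sqr_ge0.
  by rewrite mulr_ge0_le0 ?sqr_ge0 // subr_le0 ler_pdivlMr // mul1r ltW.
have -> : \sum_f product_weight w f * (cc * (1 - (\sum_(i < N) (f i)%:R) / (eps * N%:R)))
    = cc * (1 - (\sum_(i < N) \sum_f product_weight w f * (f i)%:R) / (eps * N%:R)).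
  have -> : \sum_(i < N) \sum_f product_weight w f * (f i)%:R =
      \sum_f product_weight w f * \sum_(i < N) (f i)%:R.
    by rewrite exchange_big /=; apply: eq_bigr => f _; rewrite mulr_sumr.
  transitivity (cc * (\sum_f @product_weight R bool N w f) - cc / (eps * N%:R) *
      (\sum_f product_weight w f * \sum_(i < N) (f i)%:R)).
    by rewrite !mulr_sumr -sumrB; apply: eq_bigr => f _; ring.
  by rewrite product_weight_sum1 //; ring.
under eq_bigr => i _ do rewrite (sum_product_weight1 w1 i (fun b : bool => (b : nat)%:R)).
rewrite big_bool /w /= mulr1 mulr0 addr0 sumr_const card_ord s2.
have NR : 0 < N%:R :> R by rewrite ltr0n.
rewrite /cc !exprMn s2 -mulr_natr.
rewrite le_eqVlt; apply/orP; left; apply/eqP; field.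
by rewrite !gt_eqF.
Qed.

End Contamination.

(** * Lower bound from local entropy *)

Section Testing.
Context {R : realType}.

(* Second-moment substitute for Fano's inequality: pointwise
   [W 1_A <= (T / M) W^2 + (M / (4 T)) 1_A] by AM-GM. *)
Lemma testing_bound (F : finType) (V : eqType) (S : seq V) (W : V -> F -> R)
    (A : V -> F -> bool) (chi : R) :
  (0 < size S)%N -> (0 < #|F|)%N ->
  (forall f, \sum_(v <- S) (A v f)%:R <= 1 :> R) ->
  (forall v, v \in S -> (#|F|)%:R * \sum_f W v f ^+ 2 <= chi) ->
  4 * chi <= (size S)%:R ->
  exists2 v, v \in S & \sum_f W v f * (A v f)%:R <= 1 / 2.
Proof.
move=> S0 F0 disj Wchi chiM.
set M : R := (size S)%:R in chiM; set T : R := (#|F|)%:R in Wchi.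
have M0 : 0 < M by rewrite ltr0n.
have T0 : 0 < T by rewrite ltr0n.
apply: contrapT => none.
have big v : v \in S -> 1 / 2 < \sum_f W v f * (A v f)%:R.
  by move=> vS; rewrite ltNge; apply/negP => h; apply: none; exists v.
have lo : M * (1 / 2) < \sum_(v <- S) \sum_f W v f * (A v f)%:R.
  have -> : M * (1 / 2) = \sum_(v <- S) (1 / 2).
    by rewrite big_const_seq count_predT iter_addr_0 -[RHS]mulr_natl.
  rewrite big_seq [ltRHS]big_seq; apply: ltr_sum => //.
  by case: S S0 {disj Wchi M chiM M0 none big} => // v S _; apply/hasP; exists v; rewrite ?mem_head.
have pw v f : W v f * (A v f)%:R <= T / M * W v f ^+ 2 + M / (4 * T) * (A v f)%:R.
  have TM : 0 <= T / M by rewrite divr_ge0 // ltW.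
  case: (A v f); last by rewrite !mulr0 addr0 mulr_ge0 ?sqr_ge0.
  rewrite !mulr1 -subr_ge0.
  rewrite (_ : _ - _ = T / M * (W v f - M / (2 * T)) ^+ 2).
    by rewrite mulr_ge0 ?sqr_ge0.
  by field; rewrite !gt_eqF.
have : \sum_(v <- S) \sum_f W v f * (A v f)%:R <= M * (1 / 2).
  apply: (@le_trans _ _ (\sum_(v <- S) \sum_f
    (T / M * W v f ^+ 2 + M / (4 * T) * (A v f)%:R))).
    by apply: ler_sum => v _; apply: ler_sum => f _.
  under eq_bigr do rewrite big_split /=.
  rewrite big_split /= [X in _ + X]exchange_big /=.
  have h1 : \sum_(v <- S) \sum_f T / M * W v f ^+ 2 <= chi.
    apply: (@le_trans _ _ (\sum_(v <- S) chi / M)).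
      rewrite big_seq [leRHS]big_seq; apply: ler_sum => v vS.
      by rewrite -mulr_sumr mulrAC ler_pM2r ?invr_gt0 // Wchi.
    rewrite big_const_seq count_predT iter_addr_0 -[leLHS]mulr_natl -/M mulrCA mulfV ?mulr1 //.
    by rewrite gt_eqF.
  have h2 : \sum_f \sum_(v <- S) M / (4 * T) * (A v f)%:R <= M / 4.
    apply: (@le_trans _ _ (\sum_(f : F) M / (4 * T))).
      apply: ler_sum => f _; rewrite -mulr_sumr ler_piMr //.
      by rewrite divr_ge0 ?mulr_ge0 ?(ltW M0) ?(ltW T0).
    rewrite sumr_const -[leLHS]mulr_natr -/T le_eqVlt; apply/orP; left; apply/eqP.
    by field; rewrite gt_eqF.
  lra.
by rewrite leNgt lo.
Qed.

End Testing.

Section TiltedCube.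
Context {R : realType} {n : nat}.
Variables (sigma : R) (V : n.-tuple R).
Hypotheses (sigma0 : 0 < sigma) (V_small : enorm V <= sigma).

Definition signR (b : bool) : R := if b then 1 else -1.
Definition cube_point (a : {ffun 'I_n -> bool}) : n.-tuple R := [tuple signR (a j) | j < n].
(** Probability of sign [b] in coordinate [j], tuned so that [sigma] times the sign has mean
    [tnth V j]. *)
Definition tilt (j : 'I_n) (b : bool) : R := (1 + signR b * (tnth V j / sigma)) / 2.
Definition cube_weight (a : {ffun 'I_n -> bool}) : R := \prod_(j < n) tilt j (a j).
(** Added to the mean [nu + V], it gives [nu] plus [sigma] times a vertex: the support is free of
    [V], only the weights depend on it. *)
Definition cube_noise (a : {ffun 'I_n -> bool}) : n.-tuple R :=
  vsub (vscale sigma (cube_point a)) V.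

Lemma tilt_sum j : \sum_b tilt j b = 1.
Proof. by rewrite big_bool /tilt /signR /=; field; rewrite gt_eqF. Qed.

Lemma coord_le_sigma j : `|tnth V j| <= sigma.
Proof.
apply: le_trans V_small; rewrite -(ler_pXn2r (_ : 0 < 2)%N) ?nnegrE ?enorm_ge0 //.
rewrite sqr_enorm (bigD1 j) //= real_normK ?num_real // lerDl.
by apply: sumr_ge0 => i _; exact: sqr_ge0.
Qed.

Lemma cube_weight_ge0 a : 0 <= cube_weight a.
Proof.
apply: prodr_ge0 => j _; rewrite /tilt divr_ge0 //.
have : `|tnth V j / sigma| <= 1.
  by rewrite normrM normfV (gtr0_norm sigma0) ler_pdivrMr // mul1r coord_le_sigma.
rewrite ler_norml => /andP[h1 h2]; rewrite /signR; case: (a j); lra.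
Qed.

Lemma sum_cube_weight (H : 'I_n -> bool -> R) :
  \sum_a cube_weight a * \prod_(j < n) H j (a j) = \prod_(j < n) \sum_b tilt j b * H j b.
Proof.
rewrite bigA_distr_bigA; apply: eq_bigr => f _.
by rewrite /cube_weight -big_split.
Qed.

Lemma cube_weight_sum1 : \sum_a cube_weight a = 1.
Proof.
have := sum_cube_weight (fun _ _ => 1).
under eq_bigr do rewrite big1 ?mulr1 //.
move=> ->; rewrite big1 // => j _; under eq_bigr do rewrite mulr1.
exact: tilt_sum.
Qed.

Lemma sum_cube_weight1 j (H : bool -> R) :
  \sum_a cube_weight a * H (a j) = \sum_b tilt j b * H b.
Proof.
have := sum_cube_weight (fun i => if i == j then H else fun _ => 1).
under eq_bigr => f _.
  rewrite (bigD1 j) //= eqxx big1 ?mulr1 => [|i /negPf -> //].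
  over.
move=> ->; rewrite (bigD1 j) //= eqxx [X in _ * X]big1 ?mulr1 // => i /negPf ->.
by under eq_bigr do rewrite mulr1; rewrite tilt_sum.
Qed.

Lemma sum_cube_weight2 j k (H L : bool -> R) : j != k ->
  \sum_a cube_weight a * (H (a j) * L (a k)) =
  (\sum_b tilt j b * H b) * \sum_b tilt k b * L b.
Proof.
move=> jk; have kj : k == j = false by rewrite eq_sym (negPf jk).
have := sum_cube_weight (fun i => if i == j then H else if i == k then L else fun _ => 1).
under eq_bigr => f _.
  rewrite (bigD1 j) //= eqxx (bigD1 k) ?kj //= ?eqxx big1 ?mulr1 => [|i /andP[/negPf -> /negPf ->] //].
  over.
move=> ->; rewrite (bigD1 j) //= eqxx (bigD1 k) ?kj //= eqxx.
rewrite [X in _ * (_ * X)]big1 ?mulr1 // => i /andP[/negPf -> /negPf ->].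
by under eq_bigr do rewrite mulr1; rewrite tilt_sum.
Qed.

Let z j (b : bool) : R := sigma * signR b - tnth V j.

Let zE a j : tnth (cube_noise a) j = z j (a j).
Proof. by rewrite /z !tnthE tnth_mktuple. Qed.

Let z_mean j : \sum_b tilt j b * z j b = 0.
Proof. by rewrite big_bool /z /tilt /signR /=; field; rewrite gt_eqF. Qed.

Lemma cube_noise_mean j : \sum_a cube_weight a * tnth (cube_noise a) j = 0.
Proof. by under eq_bigr do rewrite zE; rewrite (sum_cube_weight1 j (z j)). Qed.

Lemma cube_noise_var (u : n.-tuple R) :
  \sum_a cube_weight a * vdot (cube_noise a) u ^+ 2 <= sigma ^+ 2 * enorm u ^+ 2.
Proof.
have -> : \sum_a cube_weight a * vdot (cube_noise a) u ^+ 2 =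
    \sum_(j < n) \sum_(k < n) tnth u j * tnth u k *
      \sum_a cube_weight a * (z j (a j) * z k (a k)).
  under [RHS]eq_bigr => j _ do under eq_bigr => k _ do rewrite mulr_sumr.
  under [RHS]eq_bigr do rewrite exchange_big /=.
  rewrite [RHS]exchange_big /=; apply: eq_bigr => a _.
  rewrite expr2 {1}/vdot mulr_suml mulr_sumr; apply: eq_bigr => j _.
  rewrite /vdot !mulr_sumr; apply: eq_bigr => k _.
  by rewrite !zE; ring.
rewrite sqr_enorm mulr_sumr; apply: ler_sum => j _.
rewrite (bigD1 j) //= [X in _ + X]big1 => [|k kj]; last first.
  by rewrite (sum_cube_weight2 (z j) (z k)) 1?eq_sym // z_mean mul0r mulr0.
rewrite addr0 (sum_cube_weight1 j (fun b => z j b * z j b)).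
have -> : \sum_b tilt j b * (z j b * z j b) = sigma ^+ 2 - tnth V j ^+ 2.
  by rewrite big_bool /z /tilt /signR /=; field; rewrite gt_eqF.
rewrite -expr2 mulrC ler_wpM2r ?sqr_ge0 // gerBl sqr_ge0 //.
Qed.

(** The left side is one plus the chi-square divergence from the uniform law on the vertices; it
    factorises into terms [1 + (V_j / sigma)^2]. *)
Lemma cube_weight_sqr :
  (2 ^ n)%:R * \sum_a cube_weight a ^+ 2 <= expR (enorm V ^+ 2 / sigma ^+ 2).
Proof.
under eq_bigr do rewrite expr2.
rewrite (sum_cube_weight tilt).
have -> : (2 ^ n)%:R * \prod_(j < n) (\sum_b tilt j b * tilt j b) =
    \prod_(j < n) (1 + (tnth V j / sigma) ^+ 2).
  have -> : (2 ^ n)%:R = \prod_(j < n) 2 :> R by rewrite prodr_const card_ord natrX.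
  rewrite -big_split /=.
  apply: eq_bigr => j _; rewrite big_bool /tilt /signR /=; field.
  by rewrite gt_eqF.
rewrite sqr_enorm mulr_suml expR_sum; apply: ler_prod => j _.
by rewrite addr_ge0 ?sqr_ge0 //= expr_div_n expR_ge1Dx.
Qed.

End TiltedCube.

Section PackingLowerBound.
Context {R : realType}.

Lemma exists_large_packing {n : nat} (K : set (n.-tuple R)) (d c r x : R) :
  Mloc K d c = r%:E -> x < r -> exists2 nu, K nu &
    exists2 S, packing (d / c) (cball nu d `&` K) S & x < (size S)%:R.
Proof.
move=> ME xr; have : (x%:E < Mloc K d c)%E by rewrite ME lte_fin.
move=> /ereal_sup_gt[_ [nu Knu <-] /ereal_sup_gt[_ [S pS <-]]].
by rewrite lte_fin => xS; exists nu => //; exists S.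
Qed.

Lemma cube_sample_second_moment {n N : nat} (sigma b : R) (V : n.-tuple R) :
  0 < sigma -> enorm V <= b ->
  #|{ffun 'I_N -> {ffun 'I_n -> bool}}|%:R *
    \sum_(f : {ffun 'I_N -> {ffun 'I_n -> bool}}) product_weight (cube_weight sigma V) f ^+ 2 <=
  expR (N%:R * b ^+ 2 / sigma ^+ 2).
Proof.
move=> s0 Vb; under eq_bigr do rewrite expr2.
rewrite (sum_product_weight _ (fun _ => cube_weight sigma V)).
rewrite !card_ffun card_bool !card_ord natrX.
have -> : ((2 ^ n)%:R : R) ^+ N = \prod_(i < N) (2 ^ n)%:R by rewrite prodr_const card_ord.
rewrite -big_split /= prodr_const card_ord.
apply: (@le_trans _ _ (expR (enorm V ^+ 2 / sigma ^+ 2) ^+ N)).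
  apply: lerXn2r; rewrite ?nnegrE ?expR_ge0 //.
    by rewrite mulr_ge0 // sumr_ge0 // => a _; rewrite -expr2 sqr_ge0.
  under eq_bigr do rewrite -expr2.
  exact: cube_weight_sqr.
rewrite -expRM_natr ler_expR mulrC mulrA; apply: ler_wpM2r.
  by rewrite invr_ge0 sqr_ge0.
apply: ler_wpM2l => //; rewrite lerXn2r // nnegrE ?enorm_ge0 //.
exact: le_trans (enorm_ge0 V) Vb.
Qed.

Lemma minimax_packing {n N : nat} (K : set (n.-tuple R)) (sigma eps c CN d : R) :
  (0 < N)%N -> star_shapedE K -> ~ bounded_eucl K ->
  0 < sigma -> 0 < eps -> 32 <= c -> 1 <= CN ->
  ((CN%:E * ereal_sup [set elog (Mloc K delta c) | delta in [set delta : R | (0 < delta)%R]])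
      <= (N%:R)%:E)%E ->
  0 < d -> ((N%:R * d ^+ 2 / sigma ^+ 2)%:E <= elog (Mloc K d c))%E ->
  ((d ^+ 2 / (32 * c ^+ 2))%:E <= minimax_risk N K sigma eps)%E.
Proof.
move=> N0 st ub s0 e0 c32 CN1 hN d0 hd.
have c0 : 0 < c by lra.
(* Halving the radius divides the exponent of the second moment by four, so [chi ^ 4] is at most the
   local packing number at [d], hence at [d2]. *)
pose d2 := d / 2; have d20 : 0 < d2 by rewrite /d2; lra.
have d2d : d2 <= d by rewrite /d2; lra.
have ds : d <= sigma.
  have := delta_in_le st ub s0 c32 CN1 N0 hN (ltW d0) hd.
  move=> h; rewrite -(@ler_pXn2r _ 2) ?nnegrE ?(ltW s0) ?(ltW d0) //; apply: le_trans h.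
  by rewrite ler_peMl ?sqr_ge0.
have [r [ME r16 _]] := Mloc_finite st ub c32 CN1 hN d20.
have [r' [ME' r'16 _]] := Mloc_finite st ub c32 CN1 hN d0.
have rr' : r' <= r by rewrite -lee_fin -ME -ME'; exact: Mloc_nonincreasing.
have expr_r : expR (N%:R * d ^+ 2 / sigma ^+ 2) <= r.
  apply: le_trans rr'; move: hd; rewrite ME' /= lee_fin => hd.
  by rewrite -[leRHS]lnK ?posrE ?ler_expR //; clear hN; lra.
have r2 : r / 2 < r by clear hN hd expr_r; lra.
have [nu Knu [S [uS [SB pS]] rS]] := exists_large_packing ME r2.
set M : R := (size S)%:R in rS.
have M8 : 8 < M by clear hN hd; lra.
have S0 : (0 < size S)%N by rewrite -(ltr0n R) -/M; clear hN hd; lra.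
pose chi := expR (N%:R * d2 ^+ 2 / sigma ^+ 2).
have chi0 : 0 < chi by exact: expR_gt0.
have chiM : 4 * chi <= M.
  have chi4 : chi ^+ 4 < 2 * M.
    rewrite /chi -expRM_natr; apply: (@le_lt_trans _ _ r); last by clear hN hd; lra.
    apply: le_trans expr_r; rewrite ler_expR le_eqVlt; apply/orP; left; apply/eqP.
    by rewrite /d2; field; rewrite gt_eqF.
  rewrite leNgt; apply/negP => h.
  have : (M / 4) ^+ 4 < chi ^+ 4.
    by rewrite ltr_pXn2r // ?nnegrE; clear hN hd; lra.
  (* Amounts to [M^3 >= 512 = 8^3], which is why more than 8 points, half of 16, are required. *)
  have : 2 * M <= (M / 4) ^+ 4.
    rewrite (_ : (M / 4) ^+ 4 = M * (M * M * M / 256)); last by field.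
    have : 512 <= M * M * M.
      have M64 : 64 <= M * M by rewrite (_ : 64 = 8 * 8) ?ler_pM //; clear hN hd; lra.
      by rewrite (_ : 512 = 64 * 8) ?ler_pM //; clear hN hd; lra.
    by move=> M3; rewrite mulrC ler_pM2l; clear hN hd; lra.
  by clear hN hd; lra.
apply: minimax_ge => muhat mm.
pose F := {ffun 'I_N -> {ffun 'I_n -> bool}}.
pose Y (f : F) : sample R n N := [tuple vadd nu (vscale sigma (cube_point (f i))) | i < N].
(* Half the separation of the packing, so that at most one event [A v] holds. *)
pose rho := d2 / (2 * c).
pose A v f := enorm (vsub (muhat (Y f)) v) < rho.
pose W v (f : F) := product_weight (cube_weight sigma (vsub v nu)) f.
have near v : v \in S -> enorm (vsub v nu) <= d2 by move=> /SB[].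
have near_s v : v \in S -> enorm (vsub v nu) <= sigma.
  by move=> /near h; apply: (le_trans h); exact: le_trans d2d ds.
have F0 : (0 < #|{: F}|)%N by apply/card_gt0P; exists [ffun => [ffun => true]].
have disj f : \sum_(v <- S) (A v f)%:R <= 1 :> R.
  have [/hasP[v vS Avf]|/hasPn none] := boolP (has (A^~ f) S); last first.
    by rewrite big_seq big1 // => v /none /negPf ->.
  rewrite (bigD1_seq v) //= Avf big_seq_cond big1 ?addr0 // => v' /andP[v'S v'v].
  case Av'f: (A v' f) => //; exfalso.
  have := pS v' v v'S vS v'v; have := vdist_triangle (muhat (Y f)) v' v.
  move: Avf Av'f; rewrite /A (vdistC (muhat (Y f)) v') /rho => h1 h2.
  have -> : d2 / c = d2 / (2 * c) + d2 / (2 * c) by field; rewrite gt_eqF.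
  move: h1 h2; set q := d2 / (2 * c); clear hN hd expr_r; lra.
have Wchi v : v \in S -> #|{: F}|%:R * \sum_f W v f ^+ 2 <= chi.
  by move=> /near vb; exact: cube_sample_second_moment.
have [v vS vA] := testing_bound S0 F0 disj Wchi chiM.
exists v; split; first by have [] := SB v vS.
have w0 := @cube_weight_ge0 _ _ sigma (vsub v nu) s0 (near_s v vS).
have w1 : \sum_a cube_weight sigma (vsub v nu) a = 1 by exact: cube_weight_sum1.
exists (product_probability (N := N) [ffun => true] w0 w1),
  (product_noise (N := N) [ffun => true] (cube_noise sigma (vsub v nu))); split.
  apply: product_noise_iid => [j|u]; first exact: cube_noise_mean.
  exact: cube_noise_var.
exists id; split; first exact/adversary_id/ltW.
rewrite product_risk lee_fin.
have rho0 : 0 < rho by rewrite divr_gt0 // mulr_gt0.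
apply: (@le_trans _ _ (\sum_f W v f * (rho ^+ 2 * (1 - (A v f)%:R)))).
  have -> : \sum_f W v f * (rho ^+ 2 * (1 - (A v f)%:R)) =
      rho ^+ 2 * (\sum_f W v f - \sum_f W v f * (A v f)%:R).
    by rewrite -sumrB mulr_sumr; apply: eq_bigr => f _; ring.
  rewrite product_weight_sum1 //.
  have -> : d ^+ 2 / (32 * c ^+ 2) = rho ^+ 2 * (1 / 2).
    by rewrite /rho /d2; field; rewrite gt_eqF.
  by rewrite ler_wpM2l ?sqr_ge0 //; clear hN hd expr_r; lra.
apply: ler_sum => f _; apply: ler_wpM2l; first exact: product_weight_ge0.
have -> : [tuple vadd v (cube_noise sigma (vsub v nu) (f i)) | i < N] = Y f.
  apply: eq_from_tnth => i; rewrite !tnth_mktuple.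
  by apply: eq_from_tnth => j; rewrite !tnthE; ring.
rewrite /A; case: ltrP => h; first by rewrite subrr mulr0 sqr_ge0.
by rewrite subr0 mulr1 lerXn2r // nnegrE ?enorm_ge0 // ltW.
Qed.

End PackingLowerBound.

Theorem mainTheorem2 (R : realType) :
  exists c0 : R, 0 < c0 /\ forall c : R, c0 <= c ->
  exists CN A B : R, [/\ 0 < CN, 0 < A & 0 < B] /\
  forall (n N : nat) (K : set (n.-tuple R)) (sigma eps : R),
    (0 < n)%N -> (0 < N)%N ->
    star_shapedE K -> ~ bounded_eucl K ->
    0 < sigma -> 0 < eps -> eps < 1 / 32 ->
    ((CN%:E * ereal_sup [set elog (Mloc K delta c) | delta in [set delta : R | (0 < delta)%R]])
        <= (N%:R)%:E)%E ->
    let m := Order.max (delta_star K N sigma c * delta_star K N sigma c)%E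
                       ((eps * sigma ^+ 2)%:E) in
    (A%:E * m <= minimax_risk N K sigma eps /\ minimax_risk N K sigma eps <= B%:E * m)%E.
Proof.
exists 32; split => // c c32; have c0 : 0 < c by lra.
have [CN [B [CN1 B0 upper]]] := minimax_upper c32.
have A0 : 0 < (32 * c ^+ 2)^-1 by rewrite invr_gt0 mulr_gt0 // exprn_gt0.
exists CN, (32 * c ^+ 2)^-1, B; split; first by split => //; lra.
move=> n N K sigma eps n0 N0 st ub s0 e0 e32 hN m; split; last exact: upper.
have [ds dsE ds0] := delta_star_fin st ub s0 c32 CN1 N0 hN.
rewrite /m dsE -EFinM -EFin_max -EFinM.
case: (lerP (ds * ds) (eps * sigma ^+ 2)) => _.
  apply: le_trans (minimax_contamination N0 st ub s0 e0 e32).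
  rewrite lee_fin mulrC; apply: ler_wpM2l.
    by apply: mulr_ge0; [exact: ltW|exact: sqr_ge0].
  have c21 : 1 <= c ^+ 2 by rewrite exprn_ege1 //; clear hN; lra.
  by rewrite lef_pV2 ?posrE //; clear hN; lra.
have es0 : 0 <= eps * sigma ^+ 2 / 16 by rewrite divr_ge0 // (mulr_ge0 (ltW e0) (sqr_ge0 _)).
have : (0%:E <= minimax_risk N K sigma eps)%E.
  by apply: le_trans (minimax_contamination N0 st ub s0 e0 e32); rewrite lee_fin.
case riskE : (minimax_risk N K sigma eps) => [rho| |] //; last by move=> _; rewrite leey.
rewrite !lee_fin => rho0; rewrite leNgt; apply/negP => hlt.
(* The supremum [delta_star] need not be attained: too small a risk gives [x < ds], hence an
   admissible [d > x], which contradicts [minimax_packing]. *)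
pose x := Num.sqrt (rho * (32 * c ^+ 2)).
have c2 : 0 < 32 * c ^+ 2 by rewrite mulr_gt0 // exprn_gt0.
have x2 : x ^+ 2 = rho * (32 * c ^+ 2) by rewrite sqr_sqrtr // mulr_ge0 // ltW.
have xds : x < ds.
  rewrite -(@ltr_pXn2r _ 2) ?nnegrE ?sqrtr_ge0 // x2 -ltr_pdivlMr //.
  by rewrite mulrC expr2.
have : (x%:E < delta_star K N sigma c)%E by rewrite dsE lte_fin.
move=> /ereal_sup_gt[_ [d [d0 hd] <-]]; rewrite lte_fin => xd.
have dp : 0 < d by apply: le_lt_trans xd; exact: sqrtr_ge0.
have := minimax_packing N0 st ub s0 e0 c32 CN1 hN dp hd.
rewrite riskE lee_fin ler_pdivrMr // -x2 leNgt; apply/negP; rewrite negbK.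
by rewrite ltr_pXn2r // nnegrE ?sqrtr_ge0.
Qed.
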